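(* Let $G$ be a unimodular locally compact group with Haar measure, $|A|=\int_A\mathrm{d}x$. Let $p\colon G\to[0,\infty)$ satisfy $\int_Gp=1$ and $p(x)=p(x^{-1})$, and let $\Omega\subset G$ be measurable, symmetric ($x\in\Omega\Rightarrow x^{-1}\in\Omega$) with $1_G\in\Omega$. Suppose $c_0:=\inf_{x\in\Omega^2}p^{(2)}(x)>0$ and set $B=c_0|\Omega|$. Then for all integers $n,m\ge1$, $$\|\nabla p^{(2n+m)}\|_\infty\le2(mB)^{-1/2}p^{(2n)}(1_G)$$ and, for all $x\in G$, $$|p^{(2n+m)}(x)-p^{(2n+m)}(1_G)|\le2(mB)^{-1/2}\rho(x)\,p^{(2n)}(1_G).$$
   Context: $p^{(k)}=p^{\star k}$ is the $k$-fold convolution, $(p\star q)(x)=\int_Gp(y)q(y^{-1}x)\,\mathrm{d}y$. $\Omega^n=\{y_1\cdots y_n:y_i\in\Omega\}$, $\rho(x)=\inf\{n\ge1:x\in\Omega^n\}$, and for measurable $f$, $\nabla f(x)=\sup_{y\in\Omega}|f(x)-f(xy)|$. *)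

(* Defs.v *)
From HB Require Import structures.
From mathcomp Require Import all_boot all_order all_algebra.
From mathcomp Require Import all_classical all_reals all_analysis.
Set Implicit Arguments. Unset Strict Implicit. Unset Printing Implicit Defensive.
Import Order.TTheory GRing.Theory Num.Theory.
Local Open Scope classical_set_scope.
Local Open Scope ring_scope.

(* A type carrying both a topology and a sigma-algebra (the two are tied
   together, as Borel sets, by the hypothesis [lc_unimodular_haar] below). *)
HB.structure Definition TopMeasurable d := {T of Measurable d T & Topological T}.

Section Defs.
Context {d : measure_display} {R : realType} {G : TopMeasurable.type d}.
Variables (mul : G -> G -> G) (inv : G -> G) (one : G).
Variable (mu : {measure set G -> \bar R}).

Local Open Scope ereal_scope.

Definition is_group : Prop :=
  [/\ (forall x y z, mul x (mul y z) = mul (mul x y) z),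
      (forall x, mul one x = x /\ mul x one = x) &
      (forall x, mul (inv x) x = one /\ mul x (inv x) = one)].

Definition is_lc_hausdorff_topological_group : Prop :=
  [/\ is_group,
      continuous (fun z : G * G => mul z.1 z.2),
      continuous inv,
      hausdorff_space G &
      locally_compact [set: G]].

Definition is_borel_radon : Prop :=
  [/\ (@measurable d G = <<s open >>),
      (forall K : set G, compact K -> mu K < +oo),
      (forall A : set G, measurable A ->
         mu A = ereal_inf [set mu U | U in [set U | open U /\ A `<=` U]]) &
      (forall U : set G, open U ->
         mu U = ereal_sup [set mu K | K in [set K | compact K /\ K `<=` U]])].

Definition lc_unimodular_haar : Prop :=
  [/\ is_lc_hausdorff_topological_group,
      is_borel_radon,
      (forall U : set G, open U -> U !=set0 -> 0 < mu U),
      (forall x (A : set G), measurable A -> mu (mul x @` A) = mu A) &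
      (forall x (A : set G), measurable A -> mu ((fun y => mul y x) @` A) = mu A)].

Definition conv (f g : G -> \bar R) (x : G) : \bar R :=
  \int[mu]_y (f y * g (mul (inv y) x)).

(* convpow p k = p^(k), the k-fold convolution, for k >= 1
   (convpow p 0 is set to p and is never used). *)
Fixpoint convpow (p : G -> R) (k : nat) : G -> \bar R :=
  match k with
  | 0%N => fun x => (p x)%:E
  | k'.+1 => match k' with
             | 0%N => fun x => (p x)%:E
             | _ => conv (convpow p k') (fun x => (p x)%:E)
             end
  end.

Fixpoint setpow (Omega : set G) (n : nat) : set G :=
  match n with
  | 0%N => [set one]
  | n'.+1 => [set z | exists a b, setpow Omega n' a /\ Omega b /\ z = mul a b]
  end.

Definition word_length (Omega : set G) (x : G) : \bar R :=
  ereal_inf [set (n%:R)%:E | n in [set n : nat | (1 <= n)%N /\ setpow Omega n x]].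

Definition nabla (Omega : set G) (f : G -> \bar R) (x : G) : \bar R :=
  ereal_sup [set `|f x - f (mul x y)| | y in Omega].

Definition supnorm (f : G -> \bar R) : \bar R := ereal_sup [set `|f x| | x in [set: G]].

End Defs.

Definition inv_sqrtE {R : realType} (a : \bar R) : \bar R :=
  match a with
  | r%:E => if (0 < r)%R then ((Num.sqrt r)^-1)%:E else +oo%E
  | +oo%E => 0%E
  | -oo%E => +oo%E
  end.

(* Main.v *)
(* Write q k for the k-fold convolution power and b k = q (2k) one, which is the
   squared L^2 norm of q k.  For the symmetric density p, the square of the L^2
   distance between q k and its translate by y is 2 (b k - q (2k) y).  The
   triangle inequality, averaged over z in Omega with q 2 >= c0 on Omega^2,
   bounds c0 |Omega| (b k - q (2k) y), for y in Omega, by four times the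
   Dirichlet form e k = b k - b (k+1).  As e is convex (the Dirichlet form of
   q i - q j is nonnegative) and sums to at most b n over n, ..., n + 2m, its
   middle term satisfies (2m+1) e (n+m) <= b n.  Cauchy-Schwarz applied to
   q (2n+m) = q n * q (n+m) gives the gradient bound, and telescoping along a
   word in Omega gives the second inequality.

   All these inequalities come from pointwise inequalities between nonnegative
   quadratic forms, so that only Tonelli's theorem for nonnegative functions is
   used.  G need not be second countable: the multiplication of G need not be
   measurable for the product sigma-algebra, and mu need not be sigma-finite.
   Hence Tonelli's theorem is proved for the Borel sigma-algebra of the product
   topology, by inner regularity, and applied after replacing p by a density
   supported in a countable union of compact sets. *)
Require Import Defs.
From HB Require Import structures.
From mathcomp Require Import all_boot all_order all_algebra finmap.
From mathcomp Require Import all_classical all_reals all_analysis measurable_realfun.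
From mathcomp Require Import ring lra.
Import Order.TTheory GRing.Theory Num.Theory.
Local Open Scope classical_set_scope.
Local Open Scope ring_scope.

Set Implicit Arguments.
Unset Strict Implicit.
Unset Printing Implicit Defensive.

(** * Tonelli's theorem for Radon measures *)

Section topological_tonelli.
Context {d : measure_display} {R : realType} {G : TopMeasurable.type d}.
Hypothesis borelG : @measurable d G = <<s @open G >>.
Local Open Scope ereal_scope.

Local Notation GG := (g_sigma_algebraType (@open (G * G)%type)).

Lemma open_measurableG (U : set G) : open U -> measurable U.
Proof. by move=> oU; rewrite borelG; exact: sub_sigma_algebra. Qed.

Lemma preimage_borel {S T : topologicalType} (f : S -> T) (A : set T) :
  continuous f -> <<s @open T >> A -> <<s @open S >> (f @^-1` A).
Proof.
move=> /continuousP cf; move: A; apply: smallest_sub; last first.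
  by move=> U oU /=; apply: sub_sigma_algebra; exact: cf.
have [h0 hC hU] := smallest_sigma_algebra [set: S] (@open S).
split => /= [|A hA|F hF]; first by rewrite preimage_set0.
  by have := hC _ hA; rewrite !setTD.
by rewrite preimage_bigcup; exact: hU.
Qed.

Lemma measurable_section (W : set (G * G)) (phi : G -> G * G) :
  continuous phi -> <<s @open (G * G)%type >> W -> measurable (phi @^-1` W).
Proof. by move=> cphi mW; rewrite borelG; exact: preimage_borel. Qed.

Lemma continuous_pair1 (y : G) : continuous (fun z : G => (y, z)).
Proof. by move=> z; apply: cvg_pair; [exact: cvg_cst|exact: cvg_id]. Qed.

Lemma continuous_pair2 (z : G) : continuous (fun y : G => (y, z)).
Proof. by move=> y; apply: cvg_pair; [exact: cvg_id|exact: cvg_cst]. Qed.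

Lemma continuous_swap : continuous (fun u : G * G => (u.2, u.1)).
Proof.
by move=> u; apply: cvg_pair; [exact: cvg_snd|exact: cvg_fst].
Qed.

(** Stated through strict lower bounds, so that an infinite [m U] is covered too. Measurability of
    [C] is asked for because compact sets need not be closed at this stage. *)
Definition inner_regular_open (m : set G -> \bar R) :=
  forall (U : set G) (q : R), open U -> q%:E < m U ->
    exists C, [/\ compact C, measurable C, C `<=` U & q%:E < m C].

(** Tube lemma around a compact subset of one section, from the near-covering form of
    compactness. *)
Lemma tube (W : set (G * G)) (C : set G) (y0 : G) : open W -> compact C ->
  C `<=` xsection W y0 ->
  exists N, [/\ open N, N y0 & N `*` C `<=` W].
Proof.
move=> oW /compact_near_coveringP cC CW.
have : \forall y \near y0, C `<=` (fun z => W (y, z)).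
  apply: (cC _ _ (fun y z => W (y, z))) => z Cz.
  have /CW := Cz; rewrite /xsection /= inE => Wyz.
  have : nbhs (y0, z) W by apply: open_nbhs_nbhs.
  case=> -[/= A B] [nA nB] ABW.
  by exists (B, A) => //= -[/= z' y'] [Bz' Ay']; exact: (ABW (y', z')).
rewrite /prop_near1 nbhsE => -[N [oN Ny0] NP].
by exists N; split=> // -[y z] [/= Ny Cz]; exact: (NP y).
Qed.

Section one_measure.
Variables (m1 m2 : {measure set G -> \bar R}).
Hypotheses (r1 : inner_regular_open m1) (r2 : inner_regular_open m2).

Lemma open_xsection (W : set (G * G)) (y : G) : open W -> open (xsection W y).
Proof.
move=> oW; have /continuousP := @continuous_pair1 y.
move=> /(_ W oW); congr (open _).
by apply/seteqP; split => z; rewrite /xsection /= inE.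
Qed.

(** Lower semicontinuity of the measure of sections: a compact part of the section at [y0] already
    has measure above [q], and by [tube] it stays inside the sections at nearby points. *)
Lemma open_section_gt (W : set (G * G)) (q : R) : open W ->
  open [set y | q%:E < m2 (xsection W y)].
Proof.
move=> oW; rewrite openE => y0 /= h.
have [C [cC mC CW qC]] := r2 (open_xsection _ oW) h.
have [N [oN Ny0 NC]] := tube oW cC CW.
rewrite /interior nbhsE; exists N; first by split.
move=> y Ny /=; apply: lt_le_trans qC _; apply: le_measure; rewrite ?inE//.
  exact/open_measurableG/open_xsection.
by move=> z Cz; rewrite /xsection /= inE; exact: NC.
Qed.

Lemma measurable_section_measure (W : set (G * G)) : open W ->
  measurable_fun setT (fun y => m2 (xsection W y)).
Proof.
move=> oW; apply: (@measurability _ _ _ _ _ _ _ (ErealGenOInfty.measurableE R)).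
move=> _ [_ [x ->] <-]; rewrite setTI; apply: open_measurableG.
have := open_section_gt x oW; congr (open _).
by apply/seteqP; split => y /=; rewrite in_itv /= andbT.
Qed.

(* Compactness of [C] replaces the open set [W] by finitely many measurable
   rectangles inside it, without losing the lower bound [q] on the sections. *)
Lemma rectangles_above (W : set (G * G)) (C : set G) (q : R) :
  open W -> compact C -> (forall y, C y -> q%:E < m2 (xsection W y)) ->
  exists E : set (G * G), [/\ measurable E, E `<=` W &
    forall y, C y -> q%:E < m2 (xsection E y)].
Proof.
move=> oW cC hC.
have h (y : G) : exists NK : set G * set G, C y ->
    [/\ open NK.1, NK.1 y, measurable NK.2, NK.1 `*` NK.2 `<=` W & q%:E < m2 NK.2].
  have [Cy|nCy] := pselect (C y); last by exists (set0, set0).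
  have [K [cK mK KW qK]] := r2 (open_xsection _ oW) (hC _ Cy).
  have [N [oN Ny0 NC]] := tube oW cK KW.
  by exists (N, K).
have [NK hNK] := choice h.
have := cC; rewrite compact_cover => /(_ G C (fun y => (NK y).1)).
case.
- by move=> y /hNK[].
- by move=> y Cy; exists y => //; have [] := hNK _ Cy.
move=> D DC CD.
exists (\bigcup_(y in [set` D]) ((NK y).1 `*` (NK y).2)); split.
- apply: fin_bigcup_measurable; [exact: finite_fset|move=> /= y /DC].
  rewrite inE => /hNK[oN _ mK _ _].
  by apply: measurableX => //; exact: open_measurableG.
- by move=> u [y /= /DC]; rewrite inE => /hNK[_ _ _ + _]; exact.
- move=> y /CD[x /= xD Nxy].
  have /DC := xD; rewrite inE => /hNK[oN _ mK _ qK].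
  apply: lt_le_trans qK _; apply: le_measure; rewrite ?inE//.
    apply: measurable_xsection; apply: fin_bigcup_measurable; [exact: finite_fset|move=> /= z /DC].
    rewrite inE => /hNK[oN' _ mK' _ _].
    by apply: measurableX => //; exact: open_measurableG.
  by move=> z Kz; rewrite /xsection /= inE; exists x.
Qed.

End one_measure.
End topological_tonelli.

(** * Tonelli's theorem for Borel sets of the product topology *)

Section finite_measures.
Context {d : measure_display} {R : realType} {G : TopMeasurable.type d}.
Hypothesis borelG : @measurable d G = <<s @open G >>.
Local Open Scope ereal_scope.

Lemma inner_regular_fill (m : {finite_measure set G -> \bar R}) (U : set G)
    (e : R) : inner_regular_open m -> open U -> (0 < e)%R ->
  exists C, [/\ compact C, measurable C, C `<=` U & m (U `\` C) < e%:E].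
Proof.
move=> rm oU e0; have mU := open_measurableG borelG oU.
have fU : m U \is a fin_num by exact: fin_num_measure.
have [|C [cC mC CU qC]] := rm U (fine (m U) - e)%R oU.
  by rewrite EFinB fineK// lteBlDr// -[ltLHS]adde0 lteD2lE// lte_fin.
exists C; split => //.
rewrite measureD//; last by rewrite -ge0_fin_numE.
rewrite setIidr//; move: qC; rewrite EFinB fineK// => h.
by rewrite lteBlDr ?fin_num_measure// addeC -lteBlDr.
Qed.

Lemma null_of_lt_inv (m : {measure set G -> \bar R}) (A : set G) :
  (forall k, m A < (k.+1%:R^-1)%:E) -> m A = 0.
Proof.
move=> h; apply/eqP; rewrite eq_le measure_ge0 andbT.
apply/lee_addgt0Pr => e e0; rewrite add0e.
have [k _ /(_ k (leqnn k)) hk] := near_infty_natSinv_lt (PosNum e0).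
by apply: ltW; apply: lt_trans (h k) _; rewrite lte_fin.
Qed.

(* An open set of [G * G] need not belong to the product sigma-algebra, but it
   contains a countable union of rectangles with almost all the same sections:
   for each rational [q], the open set of the [y] with [q < m2 (xsection W y)]
   is exhausted up to a null set by compact sets, to which [rectangles_above]
   applies. *)
Lemma open_rectangles_ae (m1 m2 : {finite_measure set G -> \bar R})
    (W : set (G * G)) :
  inner_regular_open m1 -> inner_regular_open m2 -> open W ->
  exists E : set (G * G), [/\ measurable E, E `<=` W &
    {ae m1, forall y, m2 (xsection W y) <= m2 (xsection E y)}].
Proof.
move=> r1 r2 oW.
(* [q] enumerates the rationals through their countable coding; integers that code no rational give
   0. *)
pose q n : R := ratr (odflt 0%R (choice.unpickle n : option rat)).
pose Q n := [set y | (q n)%:E < m2 (xsection W y)].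
have oQ n : open (Q n) by exact: open_section_gt.
have h (nk : nat * nat) : exists CE : set G * set (G * G),
    [/\ measurable CE.1, m1 (Q nk.1 `\` CE.1) < (nk.2.+1%:R^-1)%:E,
        measurable CE.2, CE.2 `<=` W &
        forall y, CE.1 y -> (q nk.1)%:E < m2 (xsection CE.2 y)].
  have k0 : (0 < nk.2.+1%:R^-1 :> R)%R by rewrite invr_gt0.
  have [C [cC mC CQ mQC]] := inner_regular_fill r1 (oQ nk.1) k0.
  have [E [mE EW EC]] := rectangles_above borelG r2 oW cC CQ.
  by exists (C, E).
have [CE hCE] := choice h.
pose E := \bigcup_n \bigcup_k (CE (n, k)).2.
have mE : measurable E.
  apply: bigcupT_measurable => n; apply: bigcupT_measurable => k.
  by have [] := hCE (n, k).
exists E; split => //.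
  by move=> u [n _ [k _]]; have [_ _ _ + _] := hCE (n, k); exact.
(* [N] collects the points of some [Q n] missed by every compact set chosen for it. If the section
   of [E] at [y] is smaller than that of [W], a rational strictly between the two measures puts [y]
   in [N]: were [y] in one of the compact sets, the section of [E] would exceed that rational. *)
pose N := \bigcup_n \bigcap_k (Q n `\` (CE (n, k)).1).
have mQC n k : measurable (Q n `\` (CE (n, k)).1).
  apply: measurableD; first exact: open_measurableG.
  by have [] := hCE (n, k).
have mQ n : measurable (\bigcap_k (Q n `\` (CE (n, k)).1)).
  exact: bigcapT_measurable.
suff : m1.-negligible N.
  apply: negligibleS => y /= /negP; rewrite -ltNge => lt_E_W.
  have fE : m2 (xsection E y) \is a fin_num.
    by apply: fin_num_measure; exact: measurable_xsection.
  have fW : m2 (xsection W y) \is a fin_num.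
    by apply: fin_num_measure; exact/(open_measurableG borelG)/open_xsection.
  have [r] : exists r : rat, (ratr r : R) \in
      `](fine (m2 (xsection E y))), (fine (m2 (xsection W y)))[%R.
    by apply: rat_in_itvoo; rewrite fine_lt.
  rewrite in_itv /= => /andP[Er rW].
  exists (choice.pickle r) => // k _; split.
    by rewrite /Q /q /= choice.pickleK /= -(fineK fW) lte_fin.
  have [_ _ mE' _ CEE] := hCE (choice.pickle r, k).
  move=> /CEE; rewrite /q /= choice.pickleK /= => /lt_le_trans.
  move=> /(_ (m2 (xsection E y))) h'.
  have : (ratr r)%:E < m2 (xsection E y).
    apply: h'; apply: le_measure; rewrite ?inE.
    - exact: measurable_xsection.
    - exact: measurable_xsection.
    - apply: le_xsection => u Eu; exists (choice.pickle r) => //.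
      by exists k.
  by rewrite -(fineK fE) lte_fin ltNge (ltW Er).
apply: negligible_bigcup => n; apply/negligibleP => //.
apply: null_of_lt_inv => k; have [_ h' _ _ _] := hCE (n, k).
apply: le_lt_trans h'; apply: le_measure; rewrite ?inE //.
by move=> y; exact.
Qed.

(** The classical theorem applies to the set [E] of [open_rectangles_ae], and the inclusion of [E]
    in [W] costs only an inequality. Used for [W] and for its image under the swap of coordinates,
    this yields equality. *)
Lemma open_tonelli_le (m1 m2 : {finite_measure set G -> \bar R})
    (W : set (G * G)) :
  inner_regular_open m1 -> inner_regular_open m2 -> open W ->
  \int[m1]_y m2 (xsection W y) <=
  \int[m2]_z m1 (xsection ((fun u => (u.2, u.1)) @^-1` W) z).
Proof.
move=> r1 r2 oW; have [E [mE EW aeE]] := open_rectangles_ae r1 r2 oW.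
have oW' : open ((fun u : G * G => (u.2, u.1)) @^-1` W).
  by have /continuousP := @continuous_swap _ G; exact.
have mW := measurable_section_measure borelG r2 oW.
have mW' := measurable_section_measure borelG r1 oW'.
apply: (@le_trans _ _ (\int[m1]_y m2 (xsection E y))).
  apply: ae_ge0_le_integral => //; first exact: measurable_fun_xsection.
  by apply: filterS aeE => y + _.
have := indic_fubini_tonelli m1 m2 mE.
rewrite (indic_fubini_tonelli_FE m2 mE) (indic_fubini_tonelli_GE m1 mE) => ->.
apply: ge0_le_integral => //; first exact: measurable_fun_ysection.
move=> z _; apply: le_measure; rewrite ?inE.
- exact: measurable_ysection.
- exact/(open_measurableG borelG)/open_xsection.
- by move=> y; rewrite /ysection /xsection /= !inE => /EW.
Qed.

Section tonelli_sets.
Variables m1 m2 : {finite_measure set G -> \bar R}.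
Hypotheses (r1 : inner_regular_open m1) (r2 : inner_regular_open m2).

Let tonelli_set (W : set (G * G)) := [/\ <<s @open (G * G)%type >> W,
  measurable_fun setT (fun y => m2 (xsection W y)),
  measurable_fun setT (fun z => m1 (ysection W z)) &
  \int[m1]_y m2 (xsection W y) = \int[m2]_z m1 (ysection W z)].

Lemma borel_xsection (W : set (G * G)) (y : G) :
  <<s @open (G * G)%type >> W -> measurable (xsection W y).
Proof.
move=> sW; have := measurable_section borelG (@continuous_pair1 _ _ y) sW.
by congr measurable; apply/seteqP; split => z; rewrite /xsection /= inE.
Qed.

Lemma borel_ysection (W : set (G * G)) (z : G) :
  <<s @open (G * G)%type >> W -> measurable (ysection W z).
Proof.
move=> sW; have := measurable_section borelG (@continuous_pair2 _ _ z) sW.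
by congr measurable; apply/seteqP; split => y; rewrite /ysection /= inE.
Qed.

Let tonelli_set_open : @open (G * G)%type `<=` tonelli_set.
Proof.
move=> W oW; pose s := fun u : G * G => (u.2, u.1).
have oW' : open (s @^-1` W).
  by have /continuousP := @continuous_swap _ G; exact.
have sE z : xsection (s @^-1` W) z = ysection W z.
  by apply/seteqP; split => y; rewrite /xsection /ysection /= !inE.
have msE : measurable_fun setT (fun z => m1 (ysection W z)).
  under eq_fun do rewrite -sE; exact: measurable_section_measure.
split => //; [exact: sub_sigma_algebra|exact: measurable_section_measure|].
apply/eqP; rewrite eq_le; apply/andP; split.
  apply: le_trans (open_tonelli_le r1 r2 oW) _.
  by under eq_integral do rewrite sE.
under eq_integral do rewrite -sE.
apply: le_trans (open_tonelli_le r2 r1 oW') _.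
rewrite -comp_preimage (_ : s \o s = id) //.
by apply/funext => -[].
Qed.

(** Dynkin's argument: open sets are stable under intersection, and the sets satisfying
    [tonelli_set] form a lambda-system. Finiteness of the measures handles proper differences,
    monotone convergence handles increasing unions. *)
Lemma tonelli_set_borel (W : set (G * G)) : <<s @open (G * G)%type >> W ->
  tonelli_set W.
Proof.
move: W; apply: lambda_system_subset => //.
- by move=> A B; exact: openI.
- have [s0 sC sU] := smallest_sigma_algebra [set: G * G] (@open (G * G)%type).
  have sD A B : <<s open >> A -> <<s open >> B -> <<s @open (G * G)%type >> (A `\` B).
    exact: (@measurableD _ (g_sigma_algebraType (@open (G * G)%type))).
  split => //.
  + by apply: tonelli_set_open; exact: openT.
  + move=> A B BA [sA xA yA eA] [sB xB yB eB].
    have fin1 C : <<s @open (G * G)%type >> C -> forall y, m2 (xsection C y) < +oo.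
      by move=> sC' y; rewrite -ge0_fin_numE// fin_num_measure//; exact: borel_xsection.
    have fin2 C : <<s @open (G * G)%type >> C -> forall z, m1 (ysection C z) < +oo.
      by move=> sC' y; rewrite -ge0_fin_numE// fin_num_measure//; exact: borel_ysection.
    have xE y : m2 (xsection (A `\` B) y) = m2 (xsection A y) - m2 (xsection B y).
      rewrite xsectionD measureD ?setIidr//; try exact: borel_xsection.
      - by exact: le_xsection.
      - exact: fin1.
    have yE z : m1 (ysection (A `\` B) z) = m1 (ysection A z) - m1 (ysection B z).
      rewrite ysectionD measureD ?setIidr//; try exact: borel_ysection.
      - by exact: le_ysection.
      - exact: fin2.
    have mx : measurable_fun setT (fun y => m2 (xsection (A `\` B) y)).
      by under eq_fun do rewrite xE; exact: emeasurable_funB.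
    have my : measurable_fun setT (fun z => m1 (ysection (A `\` B) z)).
      by under eq_fun do rewrite yE; exact: emeasurable_funB.
    split => //; first exact: sD.
    have finB : \int[m1]_y m2 (xsection B y) \is a fin_num.
      rewrite ge0_fin_numE; last exact: integral_ge0.
      apply: (@le_lt_trans _ _ (\int[m1]_(y in setT) cst (m2 setT) y)).
        apply: ge0_le_integral => // y _; apply: le_measure; rewrite ?inE//.
        exact: borel_xsection.
      by rewrite integral_cst// ltey_eq fin_numM ?fin_num_measure.
    (* To avoid subtracting integrals, the finite integral of the sections of [B] is added to both
       sides and cancelled. *)
    suff : \int[m1]_y m2 (xsection (A `\` B) y) + \int[m1]_y m2 (xsection B y) =
           \int[m2]_z m1 (ysection (A `\` B) z) + \int[m1]_y m2 (xsection B y).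
      by move=> /(congr1 (fun x => x - \int[m1]_y m2 (xsection B y))); rewrite !addeK.
    rewrite [in RHS]eB -!ge0_integralD//.
    transitivity (\int[m1]_y m2 (xsection A y)).
      by apply: eq_integral => y _; rewrite xE subeK// ge0_fin_numE// fin1.
    by rewrite eA; apply: eq_integral => z _; rewrite yE subeK// ge0_fin_numE// fin2.
  + move=> F ndF hF.
    have sF : <<s open >> (\bigcup_i F i) by apply: sU => i; have [] := hF i.
    have xcvg y : m2 (xsection (F n) y) @[n --> \oo] --> m2 (xsection (\bigcup_i F i) y).
      rewrite xsection_bigcup; apply: nondecreasing_cvg_mu.
      * by move=> i; apply: borel_xsection; have [] := hF i.
      * by rewrite -xsection_bigcup; exact: borel_xsection.
      * move=> i j ij; apply/subsetPset; apply: le_xsection; exact/subsetPset/ndF.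
    have ycvg z : m1 (ysection (F n) z) @[n --> \oo] --> m1 (ysection (\bigcup_i F i) z).
      rewrite ysection_bigcup; apply: nondecreasing_cvg_mu.
      * by move=> i; apply: borel_ysection; have [] := hF i.
      * by rewrite -ysection_bigcup; exact: borel_ysection.
      * move=> i j ij; apply/subsetPset; apply: le_ysection; exact/subsetPset/ndF.
    split => //.
    * by apply: emeasurable_fun_cvg => [i|y _]; [have [_ + _ _] := hF i|exact: xcvg].
    * by apply: emeasurable_fun_cvg => [i|y _]; [have [_ _ + _] := hF i|exact: ycvg].
    * transitivity (limn (fun n => \int[m1]_y m2 (xsection (F n) y))).
        rewrite -monotone_convergence//.
        - by apply: eq_integral => y _; apply/esym/cvg_lim => //; exact: xcvg.
        - by move=> n; have [_ + _ _] := hF n.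
        - move=> y _ i j ij; apply: le_measure; rewrite ?inE.
          + by apply: borel_xsection; have [] := hF i.
          + by apply: borel_xsection; have [] := hF j.
          + by apply: le_xsection; exact/subsetPset/ndF.
      transitivity (limn (fun n => \int[m2]_z m1 (ysection (F n) z))).
        by congr (limn _); apply/funext => n; have [_ _ _ +] := hF n.
      rewrite -monotone_convergence//.
      - by apply: eq_integral => y _; apply/cvg_lim => //; exact: ycvg.
      - by move=> n; have [_ _ + _] := hF n.
      - move=> y _ i j ij; apply: le_measure; rewrite ?inE.
        + by apply: borel_ysection; have [] := hF i.
        + by apply: borel_ysection; have [] := hF j.
        + by apply: le_ysection; exact/subsetPset/ndF.
Qed.

End tonelli_sets.
End finite_measures.

(** * Tonelli's theorem for nonnegative functions *)

Section tonelli_functions.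
Context {d : measure_display} {R : realType} {G : TopMeasurable.type d}.
Local Open Scope ereal_scope.
Implicit Types (m : {measure set G -> \bar R}) (F : G * G -> \bar R).

Local Notation GG := (g_sigma_algebraType (@open (G * G)%type)).

Definition section_measurable m F :=
  (forall y, measurable_fun setT (fun z => F (y, z))) /\
  measurable_fun setT (fun y => \int[m]_z F (y, z)).

(** Measurability of the sections and of the inner integrals is bundled with the exchange of
    integrals, so that the property passes to sums, multiples and monotone limits without reference
    to a product measure. *)
Definition tonelli m1 m2 F :=
  [/\ forall u, 0 <= F u, section_measurable m2 F,
      section_measurable m1 (fun u => F (u.2, u.1)) &
      \int[m1]_y \int[m2]_z F (y, z) = \int[m2]_z \int[m1]_y F (y, z)].

Lemma section_measurableD m F1 F2 : (forall u, 0 <= F1 u) ->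
  (forall u, 0 <= F2 u) -> section_measurable m F1 -> section_measurable m F2 ->
  section_measurable m (fun u => F1 u + F2 u).
Proof.
move=> F10 F20 [a1 b1] [a2 b2]; split; first by move=> y; exact: emeasurable_funD.
under eq_fun do rewrite ge0_integralD//.
exact: emeasurable_funD.
Qed.

Lemma section_measurableZ m F (r : R) : (0 <= r)%R -> (forall u, 0 <= F u) ->
  section_measurable m F -> section_measurable m (fun u => r%:E * F u).
Proof.
move=> r0 F0 [a b]; split; first by move=> y; exact: measurable_funeM.
under eq_fun do rewrite ge0_integralZl//.
exact: measurable_funeM.
Qed.

Lemma section_measurable_cvg m (F : nat -> G * G -> \bar R)
    (L : G * G -> \bar R) :
  (forall n u, 0 <= F n u) -> (forall u, nondecreasing_seq (F ^~ u)) ->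
  (forall u, F n u @[n --> \oo] --> L u) ->
  (forall n, section_measurable m (F n)) ->
  section_measurable m L /\
  forall y, \int[m]_z F n (y, z) @[n --> \oo] --> \int[m]_z L (y, z).
Proof.
move=> F0 ndF FL hF.
have cI y : \int[m]_z F n (y, z) @[n --> \oo] --> \int[m]_z L (y, z).
  rewrite (_ : \int[m]_z L (y, z) = \int[m]_z limn (F ^~ (y, z))); last first.
    by apply: eq_integral => z _; apply/esym/cvg_lim => //; exact: FL.
  apply: cvg_monotone_convergence => //.
  by move=> n; have [+ _] := hF n; exact.
split=> //; split.
- move=> y; apply: (emeasurable_fun_cvg (fun n z => F n (y, z))).
    by move=> n; have [+ _] := hF n; exact.
  by move=> z _; exact: FL.
- apply: (emeasurable_fun_cvg (fun n y => \int[m]_z F n (y, z))).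
    by move=> n; have [] := hF n.
  by move=> y _; exact: cI.
Qed.

Lemma tonelliD m1 m2 F1 F2 : tonelli m1 m2 F1 -> tonelli m1 m2 F2 ->
  tonelli m1 m2 (fun u => F1 u + F2 u).
Proof.
move=> [F10 [a1 b1] [c1 d1] e1] [F20 [a2 b2] [c2 d2] e2].
rewrite /= in c1 d1 c2 d2; split.
- by move=> u; rewrite adde_ge0.
- exact: section_measurableD.
- by apply: section_measurableD => // u.
- have I0 m (H : G -> G -> \bar R) : (forall x y, 0 <= H x y) ->
    forall x, [set: G] x -> 0 <= \int[m]_y H x y.
    by move=> H0 x _; exact: integral_ge0.
  under eq_integral do rewrite ge0_integralD//.
  under [RHS]eq_integral do rewrite ge0_integralD//.
  rewrite (ge0_integralD m1 measurableT (I0 m2 _ _) b1 (I0 m2 _ _) b2)//.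
  rewrite (ge0_integralD m2 measurableT (I0 m1 (fun z y => F1 (y, z)) _) d1
                         (I0 m1 (fun z y => F2 (y, z)) _) d2)//.
  by rewrite e1 e2.
Qed.

Lemma tonelliZ m1 m2 F (r : R) : (0 <= r)%R -> tonelli m1 m2 F ->
  tonelli m1 m2 (fun u => r%:E * F u).
Proof.
move=> r0 [F0 [a b] [c d'] e].
rewrite /= in c d'; split.
- by move=> u; rewrite mule_ge0.
- exact: section_measurableZ.
- by apply: section_measurableZ => // u.
- under eq_integral do rewrite ge0_integralZl//.
  rewrite ge0_integralZl//; last by move=> *; exact: integral_ge0.
  under [RHS]eq_integral do rewrite ge0_integralZl//.
  rewrite ge0_integralZl//; last by move=> *; exact: integral_ge0.
  by rewrite e.
Qed.

Lemma tonelli0 m1 m2 : tonelli m1 m2 (fun=> 0).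
Proof.
have h m : section_measurable m (fun=> 0).
  by split => //; under eq_fun do rewrite integral0.
split => //; under eq_integral do rewrite integral0.
by under [RHS]eq_integral do rewrite integral0; rewrite !integral0.
Qed.

Lemma tonelli_cvg m1 m2 (F : nat -> G * G -> \bar R)
    (L : G * G -> \bar R) :
  (forall u, nondecreasing_seq (F ^~ u)) ->
  (forall u, F n u @[n --> \oo] --> L u) ->
  (forall n, tonelli m1 m2 (F n)) -> tonelli m1 m2 L.
Proof.
move=> ndF FL hF.
have F0 n u : 0 <= F n u by have [] := hF n.
have [hL1 cL1] : section_measurable m2 L /\
  forall y, \int[m2]_z F n (y, z) @[n --> \oo] --> \int[m2]_z L (y, z).
  by apply: section_measurable_cvg => // n; have [] := hF n.
have [hL2 cL2] : section_measurable m1 (fun u => L (u.2, u.1)) /\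
  forall z, \int[m1]_y F n (y, z) @[n --> \oo] --> \int[m1]_y L (y, z).
  apply: (@section_measurable_cvg m1 (fun n u => F n (u.2, u.1))) => //.
  by move=> n; have [] := hF n.
split => //.
  move=> u; rewrite -(cvg_lim _ (FL u))//.
  by apply: lime_ge; [apply/cvg_ex; exists (L u)|exact: nearW].
transitivity (limn (fun n => \int[m1]_y \int[m2]_z F n (y, z))).
  rewrite -monotone_convergence//.
  - by apply: eq_integral => y _; apply/esym/cvg_lim => //; exact: cL1.
  - by move=> n; have [_ [] ] := hF n.
  - by move=> n y _; exact: integral_ge0.
  - move=> y _ i j ij; apply: ge0_le_integral => //.
    + by have [_ [+ _] _ _] := hF i; exact.
    + by have [_ [+ _] _ _] := hF j; exact.
    + by move=> z _; exact: ndF.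
transitivity (limn (fun n => \int[m2]_z \int[m1]_y F n (y, z))).
  by congr (limn _); apply/funext => n; have [] := hF n.
rewrite -monotone_convergence//.
- by apply: eq_integral => y _; apply/cvg_lim => //; exact: cL2.
- by move=> n; have [_ _ []] := hF n.
- by move=> n y _; exact: integral_ge0.
- move=> y _ i j ij; apply: ge0_le_integral => //.
  + by have [_ _ [+ _] _] := hF i; exact.
  + by have [_ _ [+ _] _] := hF j; exact.
  + by move=> z _; exact: ndF.
Qed.

Import HBNNSimple.

Hypothesis borelG : @measurable d G = <<s @open G >>.

Lemma tonelli_borel_finite (m1 m2 : {finite_measure set G -> \bar R}) F :
  inner_regular_open m1 -> inner_regular_open m2 ->
  (forall u, 0 <= F u) -> measurable_fun setT (F : GG -> \bar R) ->
  tonelli m1 m2 F.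
Proof.
move=> r1 r2 F0 mF.
have t1 (W : set (G * G)) : <<s @open (G * G)%type >> W ->
    tonelli m1 m2 (fun u => (\1_W u)%:E).
  move=> sW; have [_ mx my e] := tonelli_set_borel borelG r1 r2 sW.
  have xI y : (fun z => (\1_W (y, z))%:E) = EFin \o \1_(xsection W y) :> (G -> \bar R).
    by apply/funext => z /=; rewrite !indicE mem_xsection.
  have yI z : (fun y => (\1_W (y, z))%:E) = EFin \o \1_(ysection W z) :> (G -> \bar R).
    by apply/funext => y /=; rewrite !indicE mem_ysection.
  have xE y : \int[m2]_z (\1_W (y, z))%:E = m2 (xsection W y).
    by rewrite xI integral_indic ?setIT//; exact: borel_xsection.
  have yE z : \int[m1]_y (\1_W (y, z))%:E = m1 (ysection W z).
    by rewrite yI integral_indic ?setIT//; exact: borel_ysection.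
  split.
  - by move=> u; rewrite lee_fin.
  - split; last by under eq_fun do rewrite xE.
    move=> y; rewrite xI; apply/measurable_EFinP/measurable_indic.
    exact: borel_xsection.
  - split; last by under eq_fun do rewrite yE.
    move=> z /=; rewrite yI; apply/measurable_EFinP/measurable_indic.
    exact: borel_ysection.
  - under eq_integral do rewrite xE.
    by under [RHS]eq_integral do rewrite yE.
pose h n : {nnsfun GG >-> R} := nnsfun_approx measurableT mF n.
refine (@tonelli_cvg m1 m2 (fun n (u : G * G) => (h n u)%:E) F _ _ _).
- move=> u i j ij; rewrite lee_fin.
  by have /(_ i j ij)/lefP/(_ u) := @nd_nnsfun_approx _ GG R setT measurableT F mF.
- move=> u.
  exact: (@cvg_nnsfun_approx _ GG R setT measurableT F mF (fun x _ => F0 x) u Logic.I).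
- move=> n.
  (* The test on the sign of [r] makes the claim true for an arbitrary list, which allows induction;
     for the values of [h n], which are nonnegative, it always succeeds. *)
  have ts (s : seq R) : tonelli m1 m2 (fun u => \sum_(r <- s)
      (if (0 <= r)%R then r%:E * (\1_(h n @^-1` [set r]) u)%:E else 0)).
    elim: s => [|r s IH]; first by under eq_fun do rewrite big_nil; exact: tonelli0.
    under eq_fun do rewrite big_cons.
    apply: (tonelliD _ IH); case: (boolP (0 <= r)%R) => [r0|_]; last exact: tonelli0.
    apply: tonelliZ => //; apply: t1.
    exact: (@measurable_sfunP _ _ GG R (h n) [set r]).
  rewrite (_ : (fun u => _) = (fun u => \sum_(r <- fset_set (range (h n)))
      (if (0 <= r)%R then r%:E * (\1_(h n @^-1` [set r]) u)%:E else 0))); first exact: ts.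
  apply/funext => u; rewrite fimfunE fsbig_finite//= -sumEFin.
  rewrite !big_seq; apply: eq_bigr => r; rewrite in_fset_set// inE => -[v _ <-].
  by rewrite fun_ge0 EFinM.
Qed.

End tonelli_functions.

(** * Radon measures: from finite restrictions to sigma-compact supports *)

Section radon_measures.
Context {d : measure_display} {R : realType} {G : TopMeasurable.type d}.
Variable mu : {measure set G -> \bar R}.
Hypotheses (hG : hausdorff_space G) (radon : is_borel_radon mu).
Local Open Scope ereal_scope.

Local Notation GG := (g_sigma_algebraType (@open (G * G)%type)).

Let borelG : @measurable d G = <<s @open G >>.
Proof. by have [] := radon. Qed.

Lemma compact_measurableG (K : set G) : compact K -> measurable K.
Proof.
move=> cK; rewrite -(setCK K); apply: measurableC; apply: open_measurableG => //.
by rewrite openC; exact: compact_closed.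
Qed.

Lemma outer_regular_lt (A : set G) (r : \bar R) : measurable A -> mu A < r ->
  exists U, [/\ open U, A `<=` U & mu U < r].
Proof.
have [_ _ outer _] := radon.
by move=> mA; rewrite outer// => /ereal_inf_lt[_ [U [oU AU] <-] UA]; exists U.
Qed.

(** Take [U] open around [A] and [F] compact in [U], each with error below [e / 2], and an open [V]
    of measure below [e / 2] containing the complement of [A] in [U]. Then [F] minus [V] is a
    compact subset of [A], and what it misses lies in the union of [V] and [U] minus [F]. *)
Lemma inner_regular_approx (A : set G) (e : R) : measurable A -> mu A < +oo ->
  (0 < e)%R ->
  exists C, [/\ compact C, measurable C, C `<=` A & mu (A `\` C) < e%:E].
Proof.
move=> mA fA e0; have e20 : (0 < e / 2)%R by rewrite divr_gt0.
have ltD (r : \bar R) : r \is a fin_num -> r < r + (e / 2)%:E.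
  by move=> rfin; rewrite -[ltLHS]adde0 lteD2lE// lte_fin.
have [U [oU AU UA]] : exists U, [/\ open U, A `<=` U & mu U < mu A + (e / 2)%:E].
  by apply: outer_regular_lt => //; apply: ltD; rewrite ge0_fin_numE.
have fU : mu U < +oo by apply: lt_le_trans UA _; rewrite leey.
have [_ _ _ inner] := radon.
have mU := open_measurableG borelG oU.
have : mu U - (e / 2)%:E < ereal_sup [set mu K | K in [set K | compact K /\ K `<=` U]].
  by rewrite -inner// lteBlDr// ltD// ge0_fin_numE.
move=> /ereal_sup_gt[_ [F [cF FU] <-] FU'].
have mF := compact_measurableG cF.
have fF : mu F < +oo by apply: le_lt_trans fU; apply: le_measure; rewrite ?inE.
have mUA := measurableD mU mA.
have [V [oV UAV VUA]] : exists V, [/\ open V, U `\` A `<=` V & mu V < (e / 2)%:E].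
  apply: outer_regular_lt => //.
  by rewrite measureD// setIidr// lteBlDr ?ge0_fin_numE// addeC.
have mV := open_measurableG borelG oV.
have UF : mu (U `\` F) < (e / 2)%:E.
  rewrite measureD// setIidr// lteBlDr ?ge0_fin_numE//.
  by rewrite addeC -lteBlDr.
have cC : compact (F `&` ~` V).
  by apply: compact_closedI => //; rewrite closedC.
exists (F `&` ~` V); split => //.
- exact: compact_measurableG.
- move=> x [Fx nVx]; apply: contrapT => nAx; apply: nVx; apply: UAV.
  by split => //; exact: FU.
- have -> : e%:E = (e / 2)%:E + (e / 2)%:E by rewrite -EFinD -splitr.
  apply: (@le_lt_trans _ _ (mu ((U `\` F) `|` V))).
    apply: le_measure; rewrite ?inE.
    + by apply: measurableD => //; exact: compact_measurableG.
    + by apply: measurableU => //; exact: measurableD.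
    + move=> x [Ax nC]; have [Vx|nVx] := pselect (V x); first by right.
      by left; split; [exact: AU|move=> Fx; apply: nC].
  apply: le_lt_trans (measureU2 _ _ _) _ => //; first exact: measurableD.
  by apply: lteD.
Qed.

(** The intersection of [U] and [K] is in general not open, but it has finite measure, so
    [inner_regular_approx] supplies the compact set. *)
Lemma inner_regular_mfrestr (K : set G) (mK : measurable K) (fK : mu K < +oo) :
  inner_regular_open (mfrestr mK fK).
Proof.
move=> U q oU; rewrite /mfrestr /mrestr => qU.
have mU := open_measurableG borelG oU.
have mUK : measurable (U `&` K) by exact: measurableI.
have fUK : mu (U `&` K) < +oo.
  by apply: le_lt_trans fK; apply: le_measure; rewrite ?inE.
have ffUK : mu (U `&` K) \is a fin_num by rewrite ge0_fin_numE.
have e0 : (0 < fine (mu (U `&` K)) - q)%R.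
  by rewrite subr_gt0 -lte_fin fineK.
have [C [cC mC CUK CE]] := inner_regular_approx mUK fUK e0.
exists C; split => //; first by move=> x /CUK[].
have CK : C `<=` K by move=> x /CUK[].
rewrite setIidl//; move: CE.
have fC : mu C \is a fin_num.
  by rewrite ge0_fin_numE//; apply: le_lt_trans fUK; apply: le_measure; rewrite ?inE.
have -> : mu (U `&` K `\` C) = (fine (mu (U `&` K)) - fine (mu C))%:E.
  by rewrite measureD// (setIidr CUK) EFinB !fineK.
by rewrite -(fineK fC) !lte_fin ltrD2l ltrN2.
Qed.

(** [mu] is the sum of its restrictions to [K] and to the complement of [K], where [f] vanishes. *)
Lemma integral_mfrestr (K : set G) (mK : measurable K) (fK : mu K < +oo)
    (f : G -> \bar R) :
  (forall x, 0 <= f x) -> measurable_fun setT f -> (forall x, ~ K x -> f x = 0) ->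
  \int[mfrestr mK fK]_x f x = \int[mu]_x f x.
Proof.
move=> f0 mf fK0; have mCK := measurableC mK.
rewrite [RHS](eq_measure_integral (measure_add (mrestr mu mK) (mrestr mu mCK))).
  rewrite ge0_integral_measure_add//.
  rewrite [X in _ = _ + X](_ : _ = 0) ?adde0//.
  have h : mrestr mu mCK K = 0 by rewrite /mrestr setICr measure0.
  rewrite (ge0_negligible_integral mK measurableT mf _ h)//.
  by apply: integral0_eq => x [_ /fK0].
move=> A mA _; apply: etrans (esym (measure_addE _ _ _)).
rewrite /= /mrestr.
rewrite -measureU//; try exact: measurableI.
  by rewrite -setIUr setUCr setIT.
by rewrite setIACA setICr setI0.
Qed.

(** The truncations of [F] to the compact rectangles [K n] times [L n] only see finite restrictions
    of [mu], for which the exchange is known, and they increase to [F]. *)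
Lemma tonelli_sigma_compact (K L : nat -> set G) (F : G * G -> \bar R) :
  (forall n, compact (K n)) -> nondecreasing_seq K ->
  (forall n, compact (L n)) -> nondecreasing_seq L ->
  (forall u, F u != 0 -> exists n, K n u.1) ->
  (forall u, F u != 0 -> exists n, L n u.2) ->
  (forall u, 0 <= F u) -> measurable_fun setT (F : GG -> \bar R) ->
  tonelli mu mu F.
Proof.
move=> cK ndK cL ndL FK FL F0 mF; have [_ finc _ _] := radon.
have mK n := compact_measurableG (cK n); have mL n := compact_measurableG (cL n).
have fK n := finc _ (cK n); have fL n := finc _ (cL n).
pose KL n : set GG := K n `*` L n.
have mKL n : measurable (KL n).
  rewrite /KL (_ : _ `*` _ = (fst @^-1` K n) `&` (snd @^-1` L n)) //.
  apply: (@measurableI _ GG); apply: preimage_borel; rewrite -?borelG//.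
  - by move=> u; exact: cvg_fst.
  - by move=> u; exact: cvg_snd.
pose Fn n : GG -> \bar R := fun u => F u * (\1_(KL n) u)%:E.
have ndKL : nondecreasing_seq KL.
  move=> i j ij; apply/subsetPset => -[y z] [/= Ky Lz]; split => /=.
    by move: Ky; exact/subsetPset/ndK.
  by move: Lz; exact/subsetPset/ndL.
have Fn0 n u : 0 <= Fn n u by rewrite /Fn mule_ge0// lee_fin.
apply: (@tonelli_cvg _ _ _ mu mu Fn F).
- move=> u i j ij; rewrite /Fn; apply: lee_wpmul2l => //.
  rewrite lee_fin !indicE; have [uK|//] := boolP (u \in KL i).
  rewrite (_ : u \in KL j)//; move: uK; rewrite !inE.
  by have /subsetPset := ndKL _ _ ij; exact.
- move=> u; have [Fu0|Fu0] := eqVneq (F u) 0.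
    by rewrite /Fn Fu0; under eq_fun do rewrite mul0e; exact: cvg_cst.
  have [i Ki] := FK _ Fu0; have [j Lj] := FL _ Fu0.
  apply: (@cvg_near_cst _ _ (F u)).
  exists (maxn i j) => //= n /=; rewrite geq_max => /andP[ni nj].
  rewrite /Fn indicE (_ : u \in KL n) ?mule1//.
  rewrite inE /KL; split => /=.
    by move: Ki; exact/subsetPset/ndK.
  by move: Lj; exact/subsetPset/ndL.
- move=> n.
  have mFn : measurable_fun setT (Fn n).
    by apply: emeasurable_funM => //; apply/measurable_EFinP/measurable_indic.
  pose a := mfrestr (mK n) (fK n); pose b := mfrestr (mL n) (fL n).
  have [_ [m1 m2] [m3 m4] e] : tonelli a b (Fn n).
    by apply: tonelli_borel_finite => //; exact: inner_regular_mfrestr.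
  rewrite /= in m3 m4.
  have FnK y z : ~ K n y -> Fn n (y, z) = 0.
    move=> nK; rewrite /Fn indicE memNset ?mule0//.
    by rewrite /KL => -[].
  have FnL y z : ~ L n z -> Fn n (y, z) = 0.
    move=> nK; rewrite /Fn indicE memNset ?mule0//.
    by rewrite /KL => -[].
  have bE y : \int[b]_z Fn n (y, z) = \int[mu]_z Fn n (y, z).
    by apply: integral_mfrestr => // z; exact: FnL.
  have aE z : \int[a]_y Fn n (y, z) = \int[mu]_y Fn n (y, z).
    by apply: integral_mfrestr => // y; exact: FnK.
  have mb : measurable_fun setT (fun y => \int[mu]_z Fn n (y, z)).
    by under eq_fun do rewrite -bE.
  have ma : measurable_fun setT (fun z => \int[mu]_y Fn n (y, z)).
    by under eq_fun do rewrite -aE.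
  split; [exact: Fn0|by split|by split|].
  transitivity (\int[a]_y \int[b]_z Fn n (y, z)).
    under [RHS]eq_integral do rewrite bE.
    rewrite integral_mfrestr//.
    + by move=> y; exact: integral_ge0.
    + by move=> y nK; apply: integral0_eq => z _; exact: FnK.
  rewrite e; under eq_integral do rewrite aE.
  rewrite integral_mfrestr//.
  + by move=> y; exact: integral_ge0.
  + by move=> y nK; apply: integral0_eq => z _; exact: FnL.
Qed.

End radon_measures.

(** * Quadratic inequalities *)

Section real_inequalities.
Variable K : realFieldType.
Implicit Types a b c d e t : K.

Lemma mean_square_le a b : 2 * (a * b) <= a * a + b * b.
Proof. by have := sqr_ge0 (a - b); rewrite expr2; lra. Qed.

(** Half of [(a - b)^2 <= 2 (a - c)^2 + 2 (c - b)^2], with the terms moved so that all coefficients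
    are nonnegative, as [convpow_quadratic_le] demands. *)
Lemma triangle_square_le a b c :
  2 * (a * c) + 2 * (c * b) <=
  2^-1 * (a * a) + 2^-1 * (b * b) + a * b + 2 * (c * c).
Proof. by have := sqr_ge0 (a + b - 2 * c); rewrite expr2; lra. Qed.

(** The hypotheses of the [collect] lemmas copy the shape in which sums over explicit lists unfold,
    hence the trailing zeros; values that coincide by translation are already identified. *)
Lemma triangle_collect a b c e :
  2 * a + (2 * b + 0) <= 2^-1 * c + (2^-1 * c + (e + (2 * c + 0))) ->
  2 * a + 2 * b <= 3 * c + e.
Proof. by lra. Qed.

(** The square behind this is that of [(a - c) - (b - e)]: later [a] and [b] are the values of [q i]
    and of its translate, [c] and [e] those of [q j] and of its translate. *)
Lemma cross_square_le a b c e :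
  2 * (a * b) + 2 * (c * e) + 2 * (a * c) + 2 * (b * e) <=
  a * a + c * c + b * b + e * e + 2 * (a * e) + 2 * (c * b).
Proof. by have := sqr_ge0 (a + e - c - b); rewrite expr2; lra. Qed.

Lemma cross_collect a b c (a1 b1 c1 : K) :
  2 * a + (2 * b + (2 * c1 + (2 * c1 + 0))) <=
    a1 + (b1 + (a1 + (b1 + (2 * c + (2 * c + 0))))) ->
  2 * a + 2 * b + 4 * c1 <= 4 * c + (2 * a1 + 2 * b1).
Proof. by lra. Qed.

(* Completing the square: the difference of the two sides is
   [(t a - (b - c))^2 / (2 t)]. *)
Lemma lipschitz_square_le a b c t : 0 < t ->
  a * b + t^-1 * (b * c) <=
  a * c + t / 2 * (a * a) + t^-1 / 2 * (b * b) + t^-1 / 2 * (c * c).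
Proof.
move=> t0; rewrite -subr_ge0.
rewrite (_ : _ - _ = t^-1 / 2 * (t * a - (b - c)) ^+ 2).
  by rewrite mulr_ge0 ?sqr_ge0// divr_ge0// invr_ge0 ltW.
by field; rewrite gt_eqF.
Qed.

Lemma lipschitz_collect a b c e k t :
  a + (t^-1 * k + 0) <= b + (t / 2 * c + (t^-1 / 2 * e + (t^-1 / 2 * e + 0))) ->
  a - b <= t / 2 * c + t^-1 * (e - k).
Proof.
rewrite !addr0 mulrBr -(mulrDl _ _ e) -splitr.
by move: (t^-1 * k) (t / 2 * c) (t^-1 * e) => x y z; lra.
Qed.

End real_inequalities.

(** * Haar measure and convolution *)

Section haar_measure.
Context {d : measure_display} {R : realType} {G : TopMeasurable.type d}.
Variables (mul : G -> G -> G) (inv : G -> G) (one : G).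
Variable mu : {measure set G -> \bar R}.
Hypothesis HG : lc_unimodular_haar mul inv one mu.
Local Open Scope ereal_scope.

Local Notation GG := (g_sigma_algebraType (@open (G * G)%type)).

Let mulA x y z : mul x (mul y z) = mul (mul x y) z.
Proof. by have [[[+ _ _] _ _ _ _] _ _ _ _] := HG; exact. Qed.

Let mul1x x : mul one x = x.
Proof. by have [[[_ /(_ x)[+ _] _] _ _ _ _] _ _ _ _] := HG. Qed.

Let mulx1 x : mul x one = x.
Proof. by have [[[_ /(_ x)[_ +] _] _ _ _ _] _ _ _ _] := HG. Qed.

Let mulVx x : mul (inv x) x = one.
Proof. by have [[[_ _ /(_ x)[+ _]] _ _ _ _] _ _ _ _] := HG. Qed.

Let mulxV x : mul x (inv x) = one.
Proof. by have [[[_ _ /(_ x)[_ +]] _ _ _ _] _ _ _ _] := HG. Qed.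

Let mulKx x y : mul (inv x) (mul x y) = y.
Proof. by rewrite mulA mulVx mul1x. Qed.

Let mulKVx x y : mul x (mul (inv x) y) = y.
Proof. by rewrite mulA mulxV mul1x. Qed.

Let mulxK x y : mul (mul y x) (inv x) = y.
Proof. by rewrite -mulA mulxV mulx1. Qed.

Let mulxKV x y : mul (mul y (inv x)) x = y.
Proof. by rewrite -mulA mulVx mulx1. Qed.

Let invK x : inv (inv x) = x.
Proof. by rewrite -[LHS]mulx1 -(mulVx x) mulKx. Qed.

Let invM x y : inv (mul x y) = mul (inv y) (inv x).
Proof.
by rewrite -[RHS](mulKx (mul x y)) -mulA mulKVx mulxV mulx1.
Qed.

Let inv1 : inv one = one.
Proof. by rewrite -[LHS]mulx1 mulVx. Qed.

Let borelG : @measurable d G = <<s @open G >>.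
Proof. by have [_ [+ _ _ _] _ _ _] := HG. Qed.

Let radon : is_borel_radon mu.
Proof. by have [_ + _ _ _] := HG. Qed.

Let hausG : hausdorff_space G.
Proof. by have [[_ _ _ + _] _ _ _ _] := HG. Qed.

Let cont_inv : continuous inv.
Proof. by have [[_ _ + _ _] _ _ _ _] := HG. Qed.

Let cont_mul (S : topologicalType) (f g : S -> G) : continuous f -> continuous g ->
  continuous (fun s => mul (f s) (g s)).
Proof.
move=> cf cg s; have [[_ cM _ _ _] _ _ _ _] := HG.
apply: (@continuous_comp _ _ _ (fun s => (f s, g s)) (fun z => mul z.1 z.2)).
  by apply: cvg_pair; [exact: cf|exact: cg].
exact: cM.
Qed.

Let cont_invc (S : topologicalType) (f : S -> G) : continuous f ->
  continuous (fun s => inv (f s)).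
Proof.
move=> cf s; apply: (@continuous_comp _ _ _ f inv); first exact: cf.
exact: cont_inv.
Qed.

Let cont_id : continuous (fun x : G => x).
Proof. by move=> x; exact: cvg_id. Qed.

Let cont_cst (x : G) : continuous (fun _ : G => x).
Proof. by move=> y; exact: cvg_cst. Qed.

Let cont_fst : continuous (fun u : G * G => u.1).
Proof. by move=> u; exact: cvg_fst. Qed.

Let cont_snd : continuous (fun u : G * G => u.2).
Proof. by move=> u; exact: cvg_snd. Qed.

Let cont_mull (x : G) : continuous (mul x).
Proof. exact: cont_mul. Qed.

Let cont_mulr (x : G) : continuous (fun y => mul y x).
Proof. exact: cont_mul. Qed.

Let cont_inv_mull (x : G) : continuous (fun y => mul (inv y) x).
Proof. exact: cont_mul. Qed.

Let cont_inv_mul : continuous (fun u : G * G => mul (inv u.1) u.2).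
Proof. by apply: cont_mul => //; exact: cont_invc. Qed.

Lemma continuous_measurableG (phi : G -> G) : continuous phi ->
  measurable_fun setT phi.
Proof.
move=> cphi _ A mA; rewrite setTI borelG; apply: preimage_borel => //.
by rewrite -borelG.
Qed.

Lemma continuous_measurableGG (phi : G * G -> G) : continuous phi ->
  measurable_fun setT (phi : GG -> G).
Proof.
move=> cphi _ A mA; rewrite setTI; apply: preimage_borel => //.
by rewrite -borelG.
Qed.

Lemma measurable_compG (f : G -> \bar R) (phi : G -> G) :
  measurable_fun setT f -> continuous phi -> measurable_fun setT (fun x => f (phi x)).
Proof.
by move=> mf cphi; apply: (measurableT_comp mf); exact: continuous_measurableG.
Qed.

Lemma measurable_compGG (f : G -> \bar R) (phi : G * G -> G) :
  measurable_fun setT f -> continuous phi ->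
  measurable_fun setT ((fun x => f (phi x)) : GG -> \bar R).
Proof.
by move=> mf cphi; apply: (measurableT_comp mf); exact: continuous_measurableGG.
Qed.

Lemma integral_invariant (phi : G -> G) (f : G -> \bar R) : continuous phi ->
  (forall A, measurable A -> mu (phi @^-1` A) = mu A) ->
  (forall x, 0 <= f x) -> measurable_fun setT f ->
  \int[mu]_x f (phi x) = \int[mu]_x f x.
Proof.
move=> cphi phimu f0 mf.
have mphi := continuous_measurableG cphi.
have := @ge0_integral_pushforward _ _ _ _ R phi mphi mu setT f measurableT mf.
rewrite preimage_setT => <- //.
by apply: eq_measure_integral => A mA _; exact: phimu.
Qed.

Lemma integral_mull (x : G) (f : G -> \bar R) :
  (forall y, 0 <= f y) -> measurable_fun setT f ->
  \int[mu]_y f (mul x y) = \int[mu]_y f y.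
Proof.
apply: integral_invariant; first exact: cont_mul.
move=> A mA; have [_ _ _ /(_ (inv x) A mA) <- _] := HG.
congr (mu _); apply/seteqP; split => [y Ay|_ [y Ay <-]] /=.
  by exists (mul x y) => //; rewrite mulKx.
by rewrite mulKVx.
Qed.

Lemma measure_preimage_mulr (x : G) (A : set G) : measurable A ->
  mu ((fun y => mul y x) @^-1` A) = mu A.
Proof.
move=> mA; have [_ _ _ _ /(_ (inv x) A mA) <-] := HG.
congr (mu _); apply/seteqP; split => [y Ay|_ [y Ay <-]] /=.
  by exists (mul y x) => //; rewrite mulxK.
by rewrite mulxKV.
Qed.

Lemma integral_mulr (x : G) (f : G -> \bar R) :
  (forall y, 0 <= f y) -> measurable_fun setT f ->
  \int[mu]_y f (mul y x) = \int[mu]_y f y.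
Proof.
apply: (@integral_invariant (fun y => mul y x)); first exact: cont_mul.
exact: measure_preimage_mulr.
Qed.

Lemma compact_mulset (K L : set G) : compact K -> compact L ->
  compact [set mul u.1 u.2 | u in K `*` L].
Proof.
move=> cK cL; apply: continuous_compact; last exact: compact_setX.
by apply: continuous_subspaceT; exact: cont_mul.
Qed.

Lemma compact_invset (K : set G) : compact K -> compact [set inv x | x in K].
Proof.
by move=> cK; apply: continuous_compact => //; exact: continuous_subspaceT.
Qed.

Definition sigma_compact_support (f : G -> \bar R) :=
  exists K : nat -> set G, [/\ forall n, compact (K n), nondecreasing_seq K &
    forall x, f x != 0 -> exists n, K n x].

(** The integrand vanishes unless [u.1] lies in some [K n] and [u.2] in some product of [K n] and
    [L n], so its support is sigma-compact in each coordinate. *)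
Lemma tonelli_convolution (f g h : G -> \bar R) :
  (forall x, 0 <= f x) -> (forall x, 0 <= g x) -> (forall x, 0 <= h x) ->
  measurable_fun setT f -> measurable_fun setT g -> measurable_fun setT h ->
  sigma_compact_support f -> sigma_compact_support g ->
  tonelli mu mu (fun u => f u.1 * g (mul (inv u.1) u.2) * h u.2).
Proof.
move=> f0 g0 h0 mf mg mh [K [cK ndK fK]] [L [cL ndL gL]].
apply: (@tonelli_sigma_compact _ _ _ mu hausG radon K
         (fun n => [set mul u.1 u.2 | u in K n `*` L n])) => //.
- by move=> n; exact: compact_mulset.
- move=> i j ij; apply/subsetPset => _ [u [Ku Lu] <-]; exists u => //; split.
    by move: Ku; exact/subsetPset/ndK.
  by move: Lu; exact/subsetPset/ndL.
- move=> u /eqP H; apply: fK; apply/eqP => fu0; apply: H.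
  by rewrite fu0 !mul0e.
- move=> u /eqP H; have [i Ki] : exists n, K n u.1.
    apply: fK; apply/eqP => fu0; apply: H.
    by rewrite fu0 !mul0e.
  have [j Lj] : exists n, L n (mul (inv u.1) u.2).
    apply: gL; apply/eqP => fu0; apply: H.
    by rewrite fu0 mule0 mul0e.
  exists (maxn i j), (u.1, mul (inv u.1) u.2); last by rewrite mulKVx.
  split => /=.
    by move: Ki; exact/subsetPset/ndK/leq_maxl.
  by move: Lj; exact/subsetPset/ndL/leq_maxr.
- by move=> u; rewrite !mule_ge0.
- apply: emeasurable_funM; first apply: emeasurable_funM.
  + exact: measurable_compGG.
  + exact: (measurable_compGG mg cont_inv_mul).
  + exact: measurable_compGG.
Qed.

Lemma compact_support_cst (f : G -> \bar R) (K : set G) : compact K ->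
  (forall x, f x != 0 -> K x) -> sigma_compact_support f.
Proof.
by move=> cK fK; exists (fun=> K); split => // x /fK; exists 0%N.
Qed.

(* Integrate [f(y) g(y^-1 z)] over [G * G] in both orders, using left
   invariance on one side and right invariance on the other. *)
Lemma integral_inv_compact (f g : G -> \bar R) (K L : set G) :
  compact K -> compact L ->
  (forall x, 0 <= f x) -> (forall x, 0 <= g x) ->
  measurable_fun setT f -> measurable_fun setT g ->
  (forall x, f x != 0 -> K x) -> (forall x, g x != 0 -> L x) ->
  (\int[mu]_x f x) * (\int[mu]_x g x) = (\int[mu]_x f x) * (\int[mu]_x g (inv x)).
Proof.
move=> cK cL f0 g0 mf mg fK gL.
have mgi := measurable_compG mg cont_inv.
have t1 : tonelli mu mu (fun u => f u.1 * g (mul (inv u.1) u.2) * 1).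
  apply: (@tonelli_convolution f g (fun=> 1)) => //.
  - exact: compact_support_cst cK fK.
  - exact: compact_support_cst cL gL.
have t2 : tonelli mu mu (fun u => g (inv u.1) * f (mul u.2 u.1)).
  apply: (@tonelli_sigma_compact _ _ _ mu hausG radon (fun=> [set inv x | x in L])
         (fun n => [set mul u.1 u.2 | u in K `*` L])) => //.
  - by move=> _; exact: compact_invset.
  - by move=> _; exact: compact_mulset.
  - move=> u /eqP H; exists 0%N; exists (inv u.1); last by rewrite invK.
    by apply: gL; apply/eqP => g0'; apply: H; rewrite g0' mul0e.
  - move=> u /eqP H; exists 0%N, (mul u.2 u.1, inv u.1); last by rewrite /= mulxK.
    split => /=; first by apply: fK; apply/eqP => h0; apply: H; rewrite h0 mule0.
    by apply: gL; apply/eqP => g0'; apply: H; rewrite g0' mul0e.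
  - by move=> u; rewrite mule_ge0.
  - apply: emeasurable_funM.
    + by apply: measurable_compGG => //; exact: cont_invc.
    + by apply: measurable_compGG => //; exact: cont_mul.
have [_ _ _ e1] := t1; have [_ _ _ e2] := t2.
rewrite /= in e1 e2.
have If0 : 0 <= \int[mu]_x f x by exact: integral_ge0.
have Ig0 : 0 <= \int[mu]_x g x by exact: integral_ge0.
transitivity (\int[mu]_y \int[mu]_z (f y * g (mul (inv y) z) * 1)).
  rewrite -(ge0_integralZr mu measurableT mf (fun x _ => f0 x) Ig0).
  apply: eq_integral => y _; under [RHS]eq_integral do rewrite mule1.
  have mgy := measurable_compG mg (@cont_mull (inv y)).
  rewrite (ge0_integralZl mu measurableT mgy (fun z _ => g0 _) (f0 y)).
  by rewrite (integral_mull (inv y) g0 mg).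
rewrite e1.
transitivity (\int[mu]_z \int[mu]_y (g (inv y) * f (mul z y))).
  apply: eq_integral => z _.
  (* Replacing [y] by [z y] turns [f(y) g(y^-1 z)] into [f(z y) g(y^-1)]. *)
  rewrite -[LHS](@integral_mull z (fun y => f y * g (mul (inv y) z) * 1)).
  - by apply: eq_integral => y _; rewrite invM -mulA mulVx mulx1 mule1 muleC.
  - by move=> y; rewrite mule1 mule_ge0.
  - under eq_fun do rewrite mule1.
    exact: (emeasurable_funM mf (measurable_compG mg (@cont_inv_mull z))).
rewrite -e2 -(ge0_integralZl mu measurableT mgi _ If0); last by move=> x _; exact: g0.
apply: eq_integral => y _.
have mfy := measurable_compG mf (@cont_mulr y).
rewrite (ge0_integralZl mu measurableT mfy (fun z _ => f0 _) (g0 _)).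
rewrite (integral_mulr y f0 mf); exact: muleC.
Qed.

(** From local compactness at [one]. The measure of such a set, finite and nonzero, is the factor
    cancelled in [measure_inv]. *)
Lemma compact_positive_measure : exists S : set G, compact S /\ 0 < mu S.
Proof.
have [[_ _ _ _ lc] _ pos _ _] := HG.
have [U nU [cU clU]] := lc one Logic.I.
exists U; split => //; rewrite withinET in nU.
have [V [oV V1] VU] : exists2 V, open_nbhs one V & V `<=` U by rewrite nbhsE in nU.
apply: (@lt_le_trans _ _ (mu V)); first by apply: pos => //; exists one.
apply: le_measure; rewrite ?inE//; first exact: open_measurableG.
exact: (compact_measurableG hausG radon cU).
Qed.

(** Invariance under inversion follows from the two translation invariances: on compact sets by
    [integral_inv_compact] against a compact set of positive measure, then on open sets by inner
    regularity and on measurable sets by outer regularity. *)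
Lemma measure_inv (A : set G) : measurable A -> mu (inv @^-1` A) = mu A.
Proof.
have preinv (B : set G) : inv @^-1` (inv @^-1` B) = B.
  by apply/seteqP; split => x /=; rewrite invK.
have invE (B : set G) : inv @^-1` B = [set inv x | x in B].
  apply/seteqP; split => [x Bx|_ [x Bx <-]] /=; last by rewrite invK.
  by exists (inv x) => //; rewrite invK.
have [S [cS S0]] := compact_positive_measure.
have [_ finc outer inner] := radon.
have mC (K : set G) : compact K -> measurable K.
  exact: (compact_measurableG hausG radon).
have onK (K : set G) : compact K -> mu (inv @^-1` K) = mu K.
  move=> cK.
  have cK' : compact (inv @^-1` K) by rewrite invE; exact: compact_invset.
  have ind (L : set G) : compact L -> measurable_fun setT (EFin \o (\1_L : G -> R)).
    by move=> cL; apply/measurable_EFinP/measurable_indic; exact: mC.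
  have supp (L : set G) x : (EFin \o (\1_L : G -> R)) x != 0 -> L x.
    by rewrite /= indicE; case: (boolP (x \in L)) => [/set_mem//|_] /eqP.
  have pos (L : set G) x : 0 <= (EFin \o (\1_L : G -> R)) x by rewrite lee_fin.
  have := integral_inv_compact cS cK (pos S) (pos K) (ind S cS) (ind K cK)
    (supp S) (supp K).
  have -> : (fun x => (EFin \o (\1_K : G -> R)) (inv x)) = EFin \o \1_(inv @^-1` K).
    by apply/funext => x /=; rewrite !indicE.
  rewrite !(integral_indic mu measurableT) ?setIT; [|exact: mC..].
  have fS := finc _ cS; have fK := finc _ cK; have fK' := finc _ cK'.
  have eS : mu S = (fine (mu S))%:E by rewrite fineK// ge0_fin_numE.
  have eK : mu K = (fine (mu K))%:E by rewrite fineK// ge0_fin_numE.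
  have eK' : mu (inv @^-1` K) = (fine (mu (inv @^-1` K)))%:E by rewrite fineK// ge0_fin_numE.
  rewrite eS eK eK' -!EFinM => -[] /mulfI -> //.
  by rewrite gt_eqF// -lte_fin -eS.
have oinv (U : set G) : open U -> open (inv @^-1` U).
  by have /continuousP := cont_inv; exact.
have onO (U : set G) : open U -> mu (inv @^-1` U) = mu U.
  move=> oU; rewrite !inner//; last exact: oinv.
  congr (ereal_sup _); apply/seteqP; split => _ [K [cK KU] <-].
    exists (inv @^-1` K); last exact: onK.
    split; first by rewrite invE; exact: compact_invset.
    by move=> x /KU /=; rewrite invK.
  exists (inv @^-1` K); last exact: onK.
  split; first by rewrite invE; exact: compact_invset.
  by move=> x /KU.
move=> mA.
have mA' : measurable (inv @^-1` A).
  by rewrite -[X in measurable X]setTI; exact: continuous_measurableG.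
rewrite !outer//; congr (ereal_inf _); apply/seteqP; split => _ [U [oU AU] <-].
  exists (inv @^-1` U); last exact: onO.
  by split; [exact: oinv|move=> x Ax; apply: AU => /=; rewrite invK].
exists (inv @^-1` U); last exact: onO.
by split; [exact: oinv|move=> x; exact: AU].
Qed.

Lemma continuous_inv_mulr (x : G) : continuous (fun y => mul (inv y) x).
Proof. exact: cont_inv_mull. Qed.

Lemma measure_inv_mulr (x : G) (A : set G) : measurable A ->
  mu ((fun y => mul (inv y) x) @^-1` A) = mu A.
Proof.
move=> mA; rewrite -(measure_preimage_mulr x mA) -[RHS]measure_inv//.
by rewrite -[X in measurable X]setTI; exact: continuous_measurableG.
Qed.

Lemma integral_inv_mulr (x : G) (f : G -> \bar R) :
  (forall y, 0 <= f y) -> measurable_fun setT f ->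
  \int[mu]_y f (mul (inv y) x) = \int[mu]_y f y.
Proof.
apply: (integral_invariant (@continuous_inv_mulr x)) => A.
exact: measure_inv_mulr.
Qed.

(** * Convolution of nonnegative functions with sigma-compact support *)

Definition conv_class (f : G -> \bar R) := [/\ forall x, 0 <= f x,
  measurable_fun setT f & sigma_compact_support f].

Local Notation conv := (Defs.conv mul inv mu).

Lemma conv_class_conv (f g : G -> \bar R) : conv_class f -> conv_class g ->
  conv_class (conv f g).
Proof.
move=> [f0 mf sf] [g0 mg sg].
have [_ _ [_ mc] _] : tonelli mu mu (fun u => f u.1 * g (mul (inv u.1) u.2) * 1).
  by apply: (@tonelli_convolution f g (fun=> 1)).
split.
- by move=> x; apply: integral_ge0 => y _; rewrite mule_ge0.
- move: mc; congr measurable_fun; apply/funext => x.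
  by apply: eq_integral => y _ /=; rewrite mule1.
- have [K [cK ndK fK]] := sf; have [L [cL ndL gL]] := sg.
  exists (fun n => [set mul u.1 u.2 | u in K n `*` L n]); split.
  + by move=> n; exact: compact_mulset.
  + move=> i j ij; apply/subsetPset => _ [u [Ku Lu] <-]; exists u => //; split.
      by move: Ku; exact/subsetPset/ndK.
    by move: Lu; exact/subsetPset/ndL.
  + move=> x; apply: contra_neqP => nx; apply: integral0_eq => y _.
    apply/eqP; rewrite mule_eq0; apply: contrapT => /negP.
    rewrite negb_or => /andP[/fK[i Ki] /gL[j Lj]].
    apply: nx; exists (maxn i j), (y, mul (inv y) x); last by rewrite /= mulKVx.
    split => /=.
      by move: Ki; exact/subsetPset/ndK/leq_maxl.
    by move: Lj; exact/subsetPset/ndL/leq_maxr.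
Qed.

(** Tonelli's theorem, then left invariance in the inner integral. Suitable choices of [h] give
    associativity and the multiplicativity of the total mass. *)
Lemma integral_conv (f g h : G -> \bar R) : conv_class f -> conv_class g ->
  (forall x, 0 <= h x) -> measurable_fun setT h ->
  \int[mu]_z (conv f g z * h z) = \int[mu]_y (f y * \int[mu]_z (g z * h (mul y z))).
Proof.
move=> [f0 mf sf] [g0 mg sg] h0 mh.
have [_ _ _ e] := tonelli_convolution f0 g0 h0 mf mg mh sf sg.
rewrite /= in e; transitivity
    (\int[mu]_z \int[mu]_y (f y * g (mul (inv y) z) * h z)).
  apply: eq_integral => z _.
  have mfg := emeasurable_funM mf (measurable_compG mg (@cont_inv_mull z)).
  have fg0 y : [set: G] y -> 0 <= f y * g (mul (inv y) z) by move=> _; exact: mule_ge0.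
  by rewrite -(ge0_integralZr mu measurableT mfg fg0 (h0 z)).
rewrite -e; apply: eq_integral => y _.
pose k z := g z * h (mul y z).
have k0 z : 0 <= k z by exact: mule_ge0.
have mk : measurable_fun setT k.
  exact: (emeasurable_funM mg (measurable_compG mh (@cont_mull y))).
have mk' := measurable_compG mk (@cont_mull (inv y)).
rewrite -(integral_mull (inv y) k0 mk).
rewrite -(ge0_integralZl mu measurableT mk' (fun z _ => k0 _) (f0 y)).
by apply: eq_integral => z _; rewrite /k mulKVx muleA.
Qed.

Lemma convA (f g h : G -> \bar R) : conv_class f -> conv_class g -> conv_class h ->
  conv (conv f g) h = conv f (conv g h).
Proof.
move=> cf cg [h0 mh _]; apply/funext => x.
pose k z := h (mul (inv z) x).
have mk : measurable_fun setT k by exact: (measurable_compG mh (@cont_inv_mull x)).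
have := integral_conv cf cg (fun z => h0 (mul (inv z) x)) mk.
rewrite /Defs.conv => ->; apply: eq_integral => y _; congr (_ * _).
by apply: eq_integral => z _; rewrite invM mulA.
Qed.

Lemma integral_convE (f g : G -> \bar R) : conv_class f -> conv_class g ->
  \int[mu]_z conv f g z = (\int[mu]_y f y) * (\int[mu]_z g z).
Proof.
move=> cf cg; have := @integral_conv f g (fun=> 1) cf cg (fun=> lee01)
  (@measurable_cst _ _ _ _ _ _).
under eq_integral do rewrite mule1.
move=> ->; have [f0 mf _] := cf; have [g0 mg _] := cg.
have Ig : 0 <= \int[mu]_x g x by exact: integral_ge0.
rewrite -(ge0_integralZr mu measurableT mf (fun x _ => f0 x) Ig).
apply: eq_integral => y _; congr (_ * _); apply: eq_integral => z _.
by rewrite mule1.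
Qed.

(** * Convolution powers of a symmetric density *)

Section convolution_powers.
Variable p : G -> R.
Hypotheses (p_class : conv_class (EFin \o p)) (p_sym : forall x, p (inv x) = p x).
Hypothesis p_int : \int[mu]_x (p x)%:E = 1.

Local Notation q := (convpow mul inv mu p).

Let qS k : (0 < k)%N -> q k.+1 = conv (q k) (q 1).
Proof. by case: k. Qed.

Lemma convpow_class k : conv_class (q k).
Proof.
elim: k => [//|[//|k] IH].
by rewrite qS//; apply: conv_class_conv.
Qed.

Let q0 k x : 0 <= q k x.
Proof. by have [] := convpow_class k. Qed.

Let mq k : measurable_fun setT (q k).
Proof. by have [] := convpow_class k. Qed.

Lemma convpowD i j : (0 < i)%N -> (0 < j)%N -> q (i + j) = conv (q i) (q j).
Proof.
move=> i0; elim: j => [//|[_ _|j IH _]]; first by rewrite addn1 qS.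
rewrite addnS qS ?addnS// -addnS IH// (qS (ltn0Sn j)) convA//; exact: convpow_class.
Qed.

Lemma convpow_int k : (0 < k)%N -> \int[mu]_x q k x = 1.
Proof.
elim: k => [//|[//|k] IH _].
rewrite qS// integral_convE; try exact: convpow_class.
by rewrite IH// mul1e; exact: p_int.
Qed.

Let conv_sym (f g : G -> \bar R) : conv_class f -> conv_class g ->
  (forall x, f (inv x) = f x) -> (forall x, g (inv x) = g x) ->
  forall x, conv f g (inv x) = conv g f x.
Proof.
move=> [f0 mf _] [g0 mg _] fs gs x.
pose k y := g y * f (mul (inv y) x).
have k0 y : 0 <= k y by exact: mule_ge0.
have mk : measurable_fun setT k.
  exact: (emeasurable_funM mg (measurable_compG mf (@cont_inv_mull x))).
rewrite [RHS]/Defs.conv -(integral_mull x k0 mk).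
apply: eq_integral => y _; rewrite /k muleC; congr (_ * _).
  by rewrite -[LHS]gs invM !invK.
by rewrite invM -mulA mulVx mulx1 fs.
Qed.

Lemma convpow_sym k x : q k (inv x) = q k x.
Proof.
elim: k x => [|[|k] IH] x; try by rewrite /= p_sym.
rewrite [in LHS]qS// conv_sym//; try exact: convpow_class.
  by rewrite -convpowD// add1n.
by move=> y; rewrite /= p_sym.
Qed.

(** Symmetry of [q j] turns the inner product of two translates into a convolution. Hence quadratic
    forms in translates of convolution powers integrate to combinations of values of convolution
    powers. *)
Lemma convpow_inner i j s t : (0 < i)%N -> (0 < j)%N ->
  \int[mu]_w (q i (mul (inv s) w) * q j (mul (inv t) w)) = q (i + j) (mul (inv s) t).
Proof.
move=> i0 j0; pose k w := q i (mul (inv s) w) * q j (mul (inv t) w).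
have k0 w : 0 <= k w by exact: mule_ge0.
have mk : measurable_fun setT k.
  apply: emeasurable_funM.
    exact: (measurable_compG (mq i) (@cont_mull _)).
  exact: (measurable_compG (mq j) (@cont_mull _)).
rewrite convpowD// -(integral_mull s k0 mk); apply: eq_integral => w _.
rewrite /k mulKx; congr (_ * _).
by rewrite -[LHS]convpow_sym !invM invK mulA.
Qed.

Let qval (w : G) (k : nat * G) := q k.1 (mul (inv k.2) w).

(* A term [(c, k1, k2)] stands for the product [c v(k1) v(k2)]; at the point
   [w], the value of the key [(i, s)] is [q i (s^-1 w)].  An inequality between
   quadratic forms with nonnegative coefficients, valid for real values and such
   that every key occurs squared on the right, then integrates to an inequality
   between values of convolution powers, infinite values included. *)
Lemma convpow_quadratic_le (s1 s2 : seq (R * (nat * G) * (nat * G))) :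
  all (fun e => [&& (0 <= e.1.1)%R, (0 < e.1.2.1)%N & (0 < e.2.1)%N]) (s1 ++ s2) ->
  all (fun k => has (fun e => [&& (0 < e.1.1)%R, e.1.2 == k & e.2 == k]) s2)
    ([seq e.1.2 | e <- s1 ++ s2] ++ [seq e.2 | e <- s1 ++ s2]) ->
  (forall v : nat * G -> R, (forall k, 0 <= v k)%R ->
    \sum_(e <- s1) e.1.1 * (v e.1.2 * v e.2) <=
    \sum_(e <- s2) e.1.1 * (v e.1.2 * v e.2))%R ->
  \sum_(e <- s1) e.1.1%:E * q (e.1.2.1 + e.2.1) (mul (inv e.1.2.2) e.2.2) <=
  \sum_(e <- s2) e.1.1%:E * q (e.1.2.1 + e.2.1) (mul (inv e.1.2.2) e.2.2).
Proof.
move=> /allP pos /allP sq H.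
have mval k : measurable_fun setT (fun w => qval w k).
  exact: (measurable_compG (mq k.1) (@cont_mull _)).
have val0 w k : 0 <= qval w k by exact: q0.
have mterm (e : R * (nat * G) * (nat * G)) :
  measurable_fun setT (fun w => e.1.1%:E * (qval w e.1.2 * qval w e.2)).
  by apply: measurable_funeM; apply: emeasurable_funM.
have intE s : {subset s <= s1 ++ s2} ->
    \sum_(e <- s) e.1.1%:E * q (e.1.2.1 + e.2.1) (mul (inv e.1.2.2) e.2.2) =
    \int[mu]_w (\sum_(e <- s) e.1.1%:E * (qval w e.1.2 * qval w e.2)).
  elim: s => [|e s IH] ss.
    by under eq_integral do rewrite big_nil; rewrite big_nil integral0.
  rewrite big_cons IH; last by move=> x xs; apply: ss; rewrite inE xs orbT.
  under [RHS]eq_integral do rewrite big_cons.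
  have /pos/and3P[c0 i0 j0] : e \in s1 ++ s2 by apply: ss; rewrite mem_head.
  have term0 w : [set: G] w -> 0 <= e.1.1%:E * (qval w e.1.2 * qval w e.2).
    by move=> _; rewrite mule_ge0// ?lee_fin// mule_ge0.
  have sum0 w : [set: G] w -> 0 <= \sum_(e <- s) e.1.1%:E * (qval w e.1.2 * qval w e.2).
    move=> _; rewrite big_seq; apply: sume_ge0 => e' e's.
    have /pos/and3P[c0' _ _] : e' \in s1 ++ s2 by apply: ss; rewrite inE e's orbT.
    by rewrite mule_ge0// ?lee_fin// mule_ge0.
  rewrite (ge0_integralD mu measurableT term0 (mterm e) sum0); last first.
    by apply: emeasurable_sum => e'.
  congr (_ + _); rewrite ge0_integralZl//.
  - by rewrite -convpow_inner.
  - exact: emeasurable_funM.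
  - by move=> w _; rewrite mule_ge0.
have sub1 : {subset s1 <= s1 ++ s2} by move=> e es; rewrite mem_cat es.
have sub2 : {subset s2 <= s1 ++ s2} by move=> e es; rewrite mem_cat es orbT.
have ge s w : {subset s <= s1 ++ s2} -> forall e, e \in s ->
    0 <= e.1.1%:E * (qval w e.1.2 * qval w e.2).
  move=> ss e /ss/pos/and3P[c0 _ _].
  by rewrite mule_ge0// ?lee_fin// mule_ge0.
rewrite !intE//; apply: ge0_le_integral => //.
- by move=> w _; rewrite big_seq; apply: sume_ge0 => e; exact: ge.
- by apply: emeasurable_sum => e.
- by apply: emeasurable_sum => e.
move=> w _.
(* At a point where some key has an infinite value, the square of that key makes the right side
   infinite; elsewhere the real inequality [H] applies. *)
have [[k kin koo]|fin] := pselect (exists2 k,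
    k \in [seq e.1.2 | e <- s1 ++ s2] ++ [seq e.2 | e <- s1 ++ s2] & qval w k = +oo).
  have /hasP[e es2 /and3P[c0 /eqP e1 /eqP e2]] := sq _ kin.
  rewrite [leRHS](big_rem e)//= e1 e2 koo mulyy gt0_muley ?lte_fin// addye ?leey//.
  rewrite gt_eqF// (lt_le_trans (ltNyr 0))// big_seq; apply: sume_ge0 => e' /mem_rem.
  exact: ge.
have finE s : {subset s <= s1 ++ s2} ->
    \sum_(e <- s) e.1.1%:E * (qval w e.1.2 * qval w e.2) =
    (\sum_(e <- s) e.1.1 * (fine (qval w e.1.2) * fine (qval w e.2)))%:E.
  move=> ss; rewrite -sumEFin big_seq [RHS]big_seq; apply: eq_bigr => e /ss es.
  have fk k : k \in [seq e.1.2 | e <- s1 ++ s2] ++ [seq e.2 | e <- s1 ++ s2] ->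
      qval w k \is a fin_num.
    move=> kin; rewrite ge0_fin_numE// ltey; apply/eqP => koo.
    by apply: fin; exists k.
  rewrite !EFinM !fineK// fk// mem_cat; apply/orP.
    by right; exact: map_f.
  by left; apply: (map_f (fun e => e.1.2)).
rewrite !finE// lee_fin; apply: (H (fun k => fine (qval w k))) => k.
exact/fine_ge0/val0.
Qed.

(** The mean inequality for [q i] and the translate of [q j] by [y]. Finiteness of the two squared
    norms thus bounds [q (i + j)] everywhere. *)
Lemma convpow_le_mean i j y : (0 < i)%N -> (0 < j)%N ->
  2%:E * q (i + j) y <= q (i + i) one + q (j + j) one.
Proof.
move=> i0 j0; have := @convpow_quadratic_le [:: (2%R, (i, one), (j, y))]
  [:: (1%R, (i, one), (i, one)); (1%R, (j, y), (j, y))].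
rewrite !big_cons !big_nil /= !adde0 !mul1e !inv1 !mul1x mulVx.
apply; rewrite ?i0 ?j0 ?eqxx ?ltr01 ?ler01 ?ler0n ?orbT//.
by move=> v _; rewrite !big_cons !big_nil /= !addr0 !mul1r; exact: mean_square_le.
Qed.

Lemma convpow_finite i j y : (0 < i)%N -> (0 < j)%N ->
  q (i + i) one < +oo -> q (j + j) one < +oo -> q (i + j) y \is a fin_num.
Proof.
move=> i0 j0 fi fj; rewrite ge0_fin_numE//.
have : 2%:E * q (i + j) y < +oo.
  by apply: le_lt_trans (convpow_le_mean _ i0 j0) _; exact: lte_add_pinfty.
by case: (q (i + j) y) => [r _||]; rewrite ?ltry// gt0_muley ?lte_fin.
Qed.

Lemma convpow_real i j : (0 < i)%N -> (0 < j)%N ->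
  q (i + i) one < +oo -> q (j + j) one < +oo ->
  exists f : G -> R, forall x, q (i + j) x = (f x)%:E.
Proof.
move=> i0 j0 fi fj; exists (fun x => fine (q (i + j) x)) => x.
by rewrite fineK// convpow_finite.
Qed.

Local Notation r := (fun k x => fine (q k x)).

(** Writing [D] for the value of [q (k + k)] at [one] minus its value at a point, this is
    [D y <= 2 D z + 2 D (z^-1 y)]; [D] is half a squared distance between translates of [q k]. *)
Lemma convpow_triangle k y z : (0 < k)%N -> q (k + k) one < +oo ->
  (2 * r (k + k)%N z + 2 * r (k + k)%N (mul (inv z) y) <=
  3 * r (k + k)%N one + r (k + k)%N y)%R.
Proof.
move=> k0 fk; have := @convpow_quadratic_le
  [:: (2%R, (k, one), (k, z)); (2%R, (k, z), (k, y))]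
  [:: (2^-1%R, (k, one), (k, one)); (2^-1%R, (k, y), (k, y));
      (1%R, (k, one), (k, y)); (2%R, (k, z), (k, z))].
rewrite !big_cons !big_nil /= !adde0 !mul1e !inv1 !mul1x !mulVx => H.
have [f E] := convpow_real k0 k0 fk fk.
move: H; rewrite !E -!EFinM -!EFinD lee_fin /=.
move=> H; apply: triangle_collect; rewrite !addr0; apply: H.
- by rewrite ?k0 ?invr_ge0 ?ler01 ?ler0n.
- by rewrite !eqxx ?invr_gt0 ?ltr01 ?ltr0n ?orbT.
- move=> v _; rewrite !big_cons !big_nil /=.
  rewrite !addr0 !mul1r !addrA; exact: triangle_square_le.
Qed.

(** Expands the fact that [q i - q j] and its translate by [y] are at a nonnegative squared
    distance. *)
Lemma convpow_cross i j y : (0 < i)%N -> (0 < j)%N ->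
  q (i + i) one < +oo -> q (j + j) one < +oo ->
  (2 * r (i + i)%N y + 2 * r (j + j)%N y + 4 * r (i + j)%N one <=
  4 * r (i + j)%N y + (2 * r (i + i)%N one + 2 * r (j + j)%N one))%R.
Proof.
move=> i0 j0 fi fj; have := @convpow_quadratic_le
  [:: (2%R, (i, one), (i, y)); (2%R, (j, one), (j, y));
      (2%R, (i, one), (j, one)); (2%R, (i, y), (j, y))]
  [:: (1%R, (i, one), (i, one)); (1%R, (j, one), (j, one));
      (1%R, (i, y), (i, y)); (1%R, (j, y), (j, y));
      (2%R, (i, one), (j, y)); (2%R, (j, one), (i, y))].
rewrite !big_cons !big_nil /= !adde0 !mul1e !inv1 !mul1x !mulVx (addnC j i) => H.
have [f Ei] := convpow_real i0 i0 fi fi.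
have [g Ej] := convpow_real j0 j0 fj fj.
have [h Eij] := convpow_real i0 j0 fi fj.
move: H; rewrite !Ei !Ej !Eij -!EFinM -!EFinD lee_fin /=.
move=> H; apply: cross_collect; rewrite !addr0; apply: H.
- by rewrite ?i0 ?j0 ?ler01 ?ler0n.
- by rewrite !eqxx ?ltr01 ?ltr0n ?orbT.
- move=> v _; rewrite !big_cons !big_nil /=.
  rewrite !addr0 !mul1r !addrA; exact: cross_square_le.
Qed.

(** Cauchy-Schwarz between [q n] and the difference of the translates of [q N] by [x] and [y], in
    the weighted form [t/2 |u|^2 + |v|^2 / (2 t)] with a free parameter [t], chosen later. *)
Lemma convpow_lipschitz n N x y (t : R) : (0 < n)%N -> (0 < N)%N -> (0 < t)%R ->
  q (n + n) one < +oo -> q (N + N) one < +oo ->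
  (r (n + N)%N x - r (n + N)%N y <= t / 2 * r (n + n)%N one +
   t^-1 * (r (N + N)%N one - r (N + N)%N (mul (inv x) y)))%R.
Proof.
move=> n0 N0 t0 fn fN; have := @convpow_quadratic_le
  [:: (1%R, (n, one), (N, x)); (t^-1%R, (N, x), (N, y))]
  [:: (1%R, (n, one), (N, y)); ((t / 2)%R, (n, one), (n, one));
      ((t^-1 / 2)%R, (N, x), (N, x)); ((t^-1 / 2)%R, (N, y), (N, y))].
rewrite !big_cons !big_nil /= !adde0 !mul1e !inv1 !mul1x !mulVx => H.
have [f En] := convpow_real n0 n0 fn fn.
have [g EN] := convpow_real N0 N0 fN fN.
have [h EnN] := convpow_real n0 N0 fn fN.
move: H; rewrite !En !EN !EnN -!EFinM -!EFinD lee_fin /=.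
move=> H; apply: lipschitz_collect; rewrite !addr0; apply: H.
- by rewrite ?n0 ?N0 ?divr_ge0 ?invr_ge0 ?ler01 ?ler0n ?(ltW t0).
- by rewrite !eqxx ?divr_gt0 ?invr_gt0 ?ltr01 ?ltr0n ?orbT.
- move=> v _; rewrite !big_cons !big_nil /=.
  rewrite !addr0 !mul1r !addrA; exact: lipschitz_square_le.
Qed.

End convolution_powers.
End haar_measure.

(** * Return probabilities *)

Section return_probabilities.
Context {d : measure_display} {R : realType} {G : TopMeasurable.type d}.
Variables (mul : G -> G -> G) (inv : G -> G) (one : G).
Variable mu : {measure set G -> \bar R}.
Hypothesis HG : lc_unimodular_haar mul inv one mu.
Variable p : G -> R.
Hypotheses (p_class : conv_class (EFin \o p)) (p_sym : forall x, p (inv x) = p x).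
Hypothesis p_int : (\int[mu]_x (p x)%:E = 1)%E.
Local Open Scope ereal_scope.

Local Notation q := (convpow mul inv mu p).

Let q0 k x : 0 <= q k x.
Proof. by have [] := convpow_class HG p_class k. Qed.

Let mq k : measurable_fun setT (q k).
Proof. by have [] := convpow_class HG p_class k. Qed.

Let mul_inv1 x : mul (inv one) x = x.
Proof.
have [[[mA /(_ x)[m1 _] V] _ _ _ _] _ _ _ _] := HG.
by have := mA (inv one) one x; rewrite m1 => ->; have [-> _] := V one.
Qed.

Lemma integral_convpow2 k : (0 < k)%N -> \int[mu]_y (q k y * q 2 y) = q (k + 2) one.
Proof.
move=> k0; have := convpow_inner HG p_class p_sym one one k0 (isT : 0 < 2)%N.
rewrite mul_inv1 => <-; apply: eq_integral => y _.
by rewrite mul_inv1.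
Qed.

(** Serves to average pointwise inequalities against the density [q 2]: values at [y] become return
    values two steps later, and constants stay because [q 2] has mass 1. *)
Lemma integral_convpow2_comb (c1 c2 K : R) i j : (0 < i)%N -> (0 < j)%N ->
  (0 <= c1)%R -> (0 <= c2)%R -> (0 <= K)%R ->
  \int[mu]_y ((c1%:E * q i y + c2%:E * q j y + K%:E) * q 2 y) =
  c1%:E * q (i + 2) one + c2%:E * q (j + 2) one + K%:E.
Proof.
move=> i0 j0 c10 c20 K0.
have mqq k : measurable_fun setT (fun y => q k y * q 2 y) by exact: emeasurable_funM.
have qq0 k y : [set: G] y -> 0 <= q k y * q 2 y by move=> _; exact: mule_ge0.
have cqq0 c k y : (0 <= c)%R -> [set: G] y -> 0 <= c%:E * (q k y * q 2 y).
  by move=> c0 _; rewrite mule_ge0 ?lee_fin// mule_ge0.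
have Kq0 y : [set: G] y -> 0 <= K%:E * q 2 y by move=> _; rewrite mule_ge0// lee_fin.
under eq_integral => y _.
  rewrite ge0_muleDl ?adde_ge0 ?mule_ge0 ?lee_fin//.
  rewrite ge0_muleDl ?mule_ge0 ?lee_fin// -!muleA; over.
rewrite ge0_integralD//; last 3 first.
- by move=> y _; rewrite adde_ge0// cqq0.
- by apply: emeasurable_funD; apply: measurable_funeM.
- exact: measurable_funeM.
rewrite ge0_integralD//; last 4 first.
- by move=> y; exact: cqq0.
- exact: measurable_funeM.
- by move=> y; exact: cqq0.
- exact: measurable_funeM.
rewrite (ge0_integralZl mu measurableT (mqq i) (qq0 i)) ?lee_fin//.
rewrite (ge0_integralZl mu measurableT (mqq j) (qq0 j)) ?lee_fin//.
rewrite (ge0_integralZl mu measurableT (mq 2) (fun y _ => q0 2 y)) ?lee_fin//.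
by rewrite !integral_convpow2// (convpow_int HG p_class p_int)// mule1.
Qed.

Lemma convpow_le_one k y : (0 < k)%N -> q (k + k) y <= q (k + k) one.
Proof.
move=> k0; have [->|fk] := eqVneq (q (k + k) one) +oo; first by rewrite leey.
have fk' : q (k + k) one < +oo by rewrite ltey.
have := convpow_le_mean HG p_class p_sym y k0 k0.
have [f E] := convpow_real HG p_class p_sym k0 k0 fk' fk'.
by rewrite !E -EFinM -EFinD !lee_fin; lra.
Qed.

(** Average of [convpow_le_one] against the density [q 2]. *)
Lemma return_decr k : (0 < k)%N -> q (k + k) one < +oo ->
  q (k.+1 + k.+1) one <= q (k + k) one.
Proof.
move=> k0 fk; have [f E] := convpow_real HG p_class p_sym k0 k0 fk fk.
have -> : (k.+1 + k.+1 = (k + k) + 2)%N by rewrite addSn addnS addn2.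
have kk0 : (0 < k + k)%N by rewrite addn_gt0 k0.
rewrite -integral_convpow2// [leRHS](_ : _ = \int[mu]_y (q (k + k) one * q 2 y)).
  apply: ge0_le_integral => //.
  - by move=> y _; exact: mule_ge0.
  - exact: emeasurable_funM.
  - exact: measurable_funeM.
  - by move=> y _; apply: lee_wpmul2r => //; exact: convpow_le_one.
by rewrite ge0_integralZl// (convpow_int HG p_class p_int)// mule1.
Qed.

(** * Convexity of finite return values and the gap over [Omega] *)

Section finite_return.
Variable n : nat.
Hypotheses (n0 : (0 < n)%N) (fn : q (n + n) one < +oo).

Let pos_of_le k : (n <= k)%N -> (0 < k)%N.
Proof. exact: leq_trans. Qed.

Lemma return_finite k : (n <= k)%N -> q (k + k) one < +oo.
Proof.
elim: k => [|k IH]; first by rewrite leqn0 => /eqP n00; move: n0; rewrite n00.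
rewrite leq_eqVlt => /orP[/eqP <-//|]; rewrite ltnS => nk.
by apply: le_lt_trans (return_decr _ (IH nk)) (IH nk); exact: pos_of_le.
Qed.

(** The squared L2 norm of [q k] as a real number. Since [fine] sends infinity to 0, it is faithful
    only under finiteness, as in [return_massE]. *)
Definition return_mass k : R := fine (q (k + k) one).
Local Notation a := return_mass.

Lemma return_massE k : (n <= k)%N -> q (k + k) one = (a k)%:E.
Proof. by move=> nk; rewrite /a fineK// ge0_fin_numE// return_finite. Qed.

Lemma return_mass_ge0 k : (0 <= a k)%R.
Proof. exact/fine_ge0. Qed.

(* The Dirichlet form of [q i - q j] is nonnegative. *)
Lemma return_convex i j l : (n <= i)%N -> (n <= j)%N -> (i + j = l + l)%N ->
  (2 * (a l - a l.+1) <= (a i - a i.+1) + (a j - a j.+1))%R.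
Proof.
move=> ni nj ijl.
have nl : (n <= l)%N.
  by rewrite -leq_double -!addnn -ijl; apply: leq_add.
have [i0 j0 l0] := And3 (pos_of_le ni) (pos_of_le nj) (pos_of_le nl).
have [fi fj fl] := And3 (return_finite ni) (return_finite nj) (return_finite nl).
have real k : (n <= k)%N -> exists f : G -> R, forall x, q (k + k) x = (f x)%:E.
  move=> nk; have k0 := pos_of_le nk; have fk := return_finite nk.
  exact: (convpow_real HG p_class p_sym k0 k0 fk fk).
have [fi' Ei] := real _ ni; have [fj' Ej] := real _ nj; have [fl' El] := real _ nl.
(* The term with coefficient 0 pads the right side to the shape required by
   [integral_convpow2_comb]. *)
have pw y : 2%:E * q (i + i) y + 2%:E * q (j + j) y + (4 * a l)%:E <=
    4%:E * q (l + l) y + 0%:E * q (l + l) y + (2 * a i + 2 * a j)%:E.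
  have := convpow_cross HG p_class p_sym y i0 j0 fi fj.
  rewrite ijl /a Ei Ej El /= Ei Ej El -!EFinM -!EFinD lee_fin /=.
  by rewrite mul0r addr0.
have kk0 k : (n <= k)%N -> (0 < k + k)%N by move=> /pos_of_le k0; rewrite addn_gt0 k0.
have : \int[mu]_y ((2%:E * q (i + i) y + 2%:E * q (j + j) y + (4 * a l)%:E) * q 2 y) <=
    \int[mu]_y ((4%:E * q (l + l) y + 0%:E * q (l + l) y + (2 * a i + 2 * a j)%:E) * q 2 y).
  have a0 := return_mass_ge0.
  apply: ge0_le_integral => //.
  - by move=> y _; rewrite mule_ge0// !adde_ge0 ?mule_ge0 ?lee_fin// mulr_ge0.
  - apply: emeasurable_funM => //; apply: emeasurable_funD => //.
    by apply: emeasurable_funD; apply: measurable_funeM.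
  - apply: emeasurable_funM => //; apply: emeasurable_funD => //.
    by apply: emeasurable_funD; apply: measurable_funeM.
  - by move=> y _; apply: lee_wpmul2r.
have a0 := return_mass_ge0.
rewrite !integral_convpow2_comb ?kk0 ?mulr_ge0 ?addr_ge0 ?mulr_ge0//.
have S k : (k + k + 2 = k.+1 + k.+1)%N by rewrite addn2 addSn addnS.
rewrite !S !return_massE ?leqW//.
rewrite -!EFinM -!EFinD lee_fin mul0r addr0.
by move: (a i) (a j) (a l) (a i.+1) (a j.+1) (a l.+1) => *; lra.
Qed.

(** By [return_convex], the decrements at [k] and at its mirror image [2m - k] average to at least
    the one at [m]. Summing over [k] compares [2m + 1] copies of the middle decrement with a
    telescoping sum. *)
Lemma return_gap m : ((m.*2.+1)%:R * (a (n + m) - a (n + m).+1) <= a n)%R.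
Proof.
pose e k := (a (n + k) - a (n + k).+1)%R.
have tele N : (\sum_(k < N) e k = a n - a (n + N))%R.
  elim: N => [|N IH]; first by rewrite big_ord0 addn0 subrr.
  by rewrite big_ord_recr /= IH /e addnS addrA subrK.
have conv (k : 'I_(m.*2.+1)) : (2 * e m <= e k + e (rev_ord k))%R.
  rewrite /e; apply: return_convex; rewrite ?leq_addr//.
  have km : (k <= m.*2)%N := ltn_ord k.
  by rewrite /= subSS addnACA (subnKC km) -addnn addnACA.
have : (\sum_(k < m.*2.+1) 2 * e m <= \sum_(k < m.*2.+1) (e k + e (rev_ord k)))%R.
  by apply: ler_sum => k _; exact: conv.
have -> : (\sum_(k < m.*2.+1) (e k + e (rev_ord k)) =
    (\sum_(k < m.*2.+1) e k) *+ 2)%R.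
  rewrite big_split mulr2n; congr (_ + _)%R.
  rewrite (reindex_inj rev_ord_inj); apply: eq_bigr => k _.
  by rewrite rev_ordK.
rewrite sumr_const card_ord tele -mulrnAr -[X in (_ <= X)%R]mulr_natl.
rewrite ler_pM2l// -[X in (X <= _)%R -> _]mulr_natl => h.
by apply: le_trans h _; rewrite gerBl return_mass_ge0.
Qed.

(** The inequality [D y <= 2 D z + 2 D (z^-1 y)] is multiplied by [c0], which is then replaced by
    [q 2 z] in one term and by [q 2 (z^-1 y)] in the other, and integrated over [Omega]. Extended to
    [G], both integrals equal the decrement of [a] at [k], the second by inversion and translation
    invariance; hence the factor 4. *)
Lemma Omega_gap (Omega : set G) (c0 : \bar R) k y : (n <= k)%N -> measurable Omega ->
  0 <= c0 ->
  (forall z, Omega z -> c0 <= q 2 z /\ c0 <= q 2 (mul (inv z) y)) ->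
  c0 * mu Omega * (a k - fine (q (k + k) y))%:E <= (4 * (a k - a k.+1))%:E.
Proof.
move=> nk mO c00 hO; have k0 := pos_of_le nk; have fk := return_finite nk.
have [f E] := convpow_real HG p_class p_sym k0 k0 fk fk.
pose D z := (a k)%:E - q (k + k) z.
have DE z : D z = (a k - f z)%:E by rewrite /D E.
have D0 z : 0 <= D z.
  by rewrite /D sube_ge0 ?E// -E -return_massE// convpow_le_one.
have mD : measurable_fun setT D by exact: emeasurable_funB.
pose H z := D z * q 2 z.
have H0 z : 0 <= H z by exact: mule_ge0.
have mH : measurable_fun setT H by exact: emeasurable_funM.
have intH : \int[mu]_z H z = (a k - a k.+1)%:E.
  have : \int[mu]_z H z + \int[mu]_z (q (k + k) z * q 2 z) = (a k)%:E.
    rewrite -ge0_integralD//; last 2 first.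
    - by move=> z _; exact: mule_ge0.
    - exact: emeasurable_funM.
    rewrite -[RHS]mule1 -(convpow_int HG p_class p_int (isT : 0 < 2)%N).
    rewrite -ge0_integralZl ?lee_fin ?return_mass_ge0//.
    apply: eq_integral => z _; rewrite /H -ge0_muleDl// DE E -EFinD.
    by rewrite subrK.
  rewrite integral_convpow2 ?addn_gt0 ?k0//.
  have -> : (k + k + 2 = k.+1 + k.+1)%N by rewrite addn2 addSn addnS.
  rewrite return_massE ?leqW// => h.
  by rewrite EFinB -h addeK.
have mHi : measurable_fun setT (fun z => H (mul (inv z) y)).
  exact: (measurable_compG HG mH (continuous_inv_mulr HG (x := y))).
have intHi : \int[mu]_z H (mul (inv z) y) = \int[mu]_z H z.
  exact: (integral_inv_mulr HG).
have HE z : H z = D z * q 2 z by [].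
clearbody H; clearbody D.
have tri z : D y <= 2%:E * D z + 2%:E * D (mul (inv z) y).
  have := convpow_triangle HG p_class p_sym y z k0 fk.
  rewrite !DE -!EFinM -EFinD lee_fin /a !E /=.
  by move: (f y) (f z) (f (mul _ _)) (f one) => *; lra.
have -> : c0 * mu Omega * (a k - fine (q (k + k) y))%:E =
    \int[mu]_(z in Omega) cst (c0 * D y) z.
  by rewrite (integral_cst mu mO) DE E /= muleAC.
pose S z := 2%:E * H z + 2%:E * H (mul (inv z) y).
have S0 z : 0 <= S z by rewrite adde_ge0// mule_ge0.
have mS : measurable_fun setT S by apply: emeasurable_funD; exact: measurable_funeM.
have SE : \int[mu]_z S z = \int[mu]_z (2%:E * H z) + \int[mu]_z (2%:E * H (mul (inv z) y)).
  rewrite ge0_integralD//; last 4 first.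
  - by move=> z _; rewrite mule_ge0.
  - exact: measurable_funeM.
  - by move=> z _; rewrite mule_ge0.
  - exact: measurable_funeM.
have cD0 : 0 <= c0 * D y by exact: mule_ge0.
have cDS z : Omega z -> cst (c0 * D y) z <= S z.
  move=> Oz; have [h1 h2] := hO z Oz.
    apply: (@le_trans _ _ (c0 * (2%:E * D z + 2%:E * D (mul (inv z) y)))).
      exact: lee_wpmul2l.
    have h x : c0 <= q 2 x -> c0 * (2%:E * D x) <= 2%:E * H x.
      move=> hx; rewrite muleCA; apply: lee_wpmul2l; first by rewrite lee_fin.
      by rewrite HE muleC; apply: lee_wpmul2l.
    have D20 x : 0 <= 2%:E * D x by rewrite mule_ge0.
    by rewrite (ge0_muleDr _ (D20 _) (D20 _)); apply: leeD; exact: h.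
apply: (@le_trans _ _ (\int[mu]_(z in Omega) S z)).
  by apply: (ge0_le_integral mu mO) => //; exact: measurable_funTS.
apply: (@le_trans _ _ (\int[mu]_z S z)).
  by apply: (ge0_subset_integral mu mO measurableT mS).
rewrite SE !ge0_integralZl ?lee_fin// intHi intH -!EFinM -EFinD lee_fin.
by move: (a k) (a k.+1) => *; lra.
Qed.

End finite_return.
End return_probabilities.

(** * Reduction to densities with sigma-compact support *)

Section representative.
Context {d : measure_display} {R : realType} {G : TopMeasurable.type d}.
Variables (mul : G -> G -> G) (inv : G -> G) (one : G).
Variable mu : {measure set G -> \bar R}.
Hypothesis HG : lc_unimodular_haar mul inv one mu.
Local Open Scope ereal_scope.

Lemma measurable_superlevel (p : G -> R) (e : R) : measurable_fun setT p ->
  measurable [set x | (e < p x)%R].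
Proof.
move=> mp; rewrite (_ : [set _ | _] = setT `&` p @^-1` `]e, +oo[%classic).
  exact: mp.
by apply/seteqP; split => x /=; rewrite in_itv /= andbT // => -[].
Qed.

(** Markov's inequality; finite measure is what approximation from inside by compact sets asks
    for. *)
Lemma superlevel_finite (p : G -> R) (e : R) : (forall x, 0 <= p x)%R ->
  measurable_fun setT p -> \int[mu]_x (p x)%:E < +oo -> (0 < e)%R ->
  measurable [set x | (e < p x)%R] /\ mu [set x | (e < p x)%R] < +oo.
Proof.
move=> p0 mp ip e0; have mS := measurable_superlevel e mp.
split => //.
have : e%:E * mu [set x | (e < p x)%R] <= \int[mu]_x (p x)%:E.
  rewrite -(integral_cst mu mS).
  apply: (@le_trans _ _ (\int[mu]_(x in [set x | (e < p x)%R]) (p x)%:E)).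
    apply: ge0_le_integral => //.
    - by move=> x _; rewrite lee_fin ltW.
    - by apply/measurable_EFinP; exact: measurable_funTS.
    - by move=> x /= /ltW; rewrite lee_fin.
  apply: ge0_subset_integral => //; first exact/measurable_EFinP.
  by move=> x _; rewrite lee_fin.
move=> /le_lt_trans/(_ ip); case: (mu _) => [r||] //; first by move=> _; rewrite ltry.
by rewrite gt0_muley ?lte_fin.
Qed.

(* The convolution powers of order at least 2 only depend on the class of [p]
   modulo null sets, and [p], being integrable, vanishes almost everywhere
   outside of a countable union of compact sets. *)
Lemma sigma_compact_representative (p : G -> R) : (forall x, 0 <= p x)%R ->
  measurable_fun setT p -> \int[mu]_x (p x)%:E = 1 ->
  (forall x, p (inv x) = p x) ->
  exists p' : G -> R, [/\ conv_class (EFin \o p'), forall x, p' (inv x) = p' x,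
    \int[mu]_x (p' x)%:E = 1 &
    forall k, convpow mul inv mu p k.+2 = convpow mul inv mu p' k.+2].
Proof.
move=> p0 mp ip p_sym.
have [[[mA m1 mV] _ _ hG _] radon _ _ _] := HG.
have invK x : inv (inv x) = x.
  have [_ e] := m1 (inv (inv x)); have [e' _] := mV x.
  have [e'' _] := mV (inv x); have [e1 _] := m1 x.
  by rewrite -[LHS]e -e' mA e'' e1.
pose S n := [set x | (n.+1%:R^-1 < p x)%R].
have Sn n : measurable (S n) /\ mu (S n) < +oo.
  by apply: superlevel_finite => //; rewrite ?ip ?ltry// invr_gt0.
have hC n : exists C, [/\ compact C, measurable C, C `<=` S n &
    mu (S n `\` C) < (n.+1%:R^-1)%:E].
  have [mS fS] := Sn n.
  by apply: (inner_regular_approx hG radon mS fS); rewrite invr_gt0.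
have [C CP] := choice hC.
(* Inverses are adjoined so that [T] is symmetric and the cut-off of [p] to [T] remains
   symmetric. *)
pose Ci n := C n `|` inv @` C n.
pose K n := \big[setU/set0]_(i < n.+1) Ci i.
have cK n : compact (K n).
  apply: bigsetU_compact => i _; apply: compactU.
    by have [] := CP i.
  by apply: (compact_invset HG); have [] := CP i.
have ndK : nondecreasing_seq K.
  by move=> i j ij; apply/subsetPset; exact: subset_bigsetU.
pose T := \bigcup_n K n.
have mT : measurable T.
  by apply: bigcupT_measurable => n; exact: (compact_measurableG hG radon).
have Tsym x : T x -> T (inv x).
  move=> [n _]; rewrite /K -bigcup_mkord => -[i /= iN Cx].
  exists n => //; rewrite /K -bigcup_mkord; exists i => //.
  by case: Cx => [Cx|[y Cy <-]]; [right; exists x|left; rewrite invK].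
have CT n : C n `<=` T.
  move=> x Cx; exists n => //; rewrite /K -bigcup_mkord; exists n => //=.
  by left.
pose p' x : R := (p x * \1_T x)%R.
have mp' : measurable_fun setT p'.
  by apply: measurable_funM => //; exact: measurable_indic.
have p'0 x : (0 <= p' x)%R by rewrite /p' mulr_ge0.
pose N := [set x | (0 < p x)%R] `\` T.
have mN : measurable N.
  apply: measurableD => //.
  exact: measurable_superlevel.
have mu_N : mu N = 0.
  apply/(negligibleP mu mN).
  apply: (@negligibleS _ _ _ _ (\bigcup_k (S k `\` T))).
    move=> x [/= px nT].
    have [k _ /(_ k (leqnn k)) hk] := near_infty_natSinv_lt (PosNum px).
    by exists k.
  apply: negligible_bigcup => k; have [mSk _] := Sn k.
  have mSkT : measurable (S k `\` T) by exact: measurableD.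
  apply/negligibleP => //; apply: null_of_lt_inv => l.
  (* The sets [S] increase with the index, so [S k] minus [T] is also missed by the compact set of
     index [maxn k l], whose error is below [1 / (l + 1)]. *)
  have [_ mC _ lC] := CP (maxn k l); have [mS _] := Sn (maxn k l).
  apply: (@le_lt_trans _ _ (mu (S (maxn k l) `\` C (maxn k l)))).
    apply: le_measure; rewrite ?inE//; first exact: measurableD.
    move=> x [Sx nT]; split; last by move=> /CT.
    apply: le_lt_trans Sx; rewrite lef_pV2 ?posrE// ler_nat ltnS.
    exact: leq_maxl.
  apply: lt_le_trans lC _; rewrite lee_fin lef_pV2 ?posrE// ler_nat ltnS.
  exact: leq_maxr.
have pE x : ~ N x -> p x = p' x.
  move=> nN; rewrite /p' indicE; have [Tx|/negP nT] := boolP (x \in T).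
    by rewrite mulr1.
  rewrite mulr0; apply/eqP; rewrite eq_le p0 andbT leNgt; apply/negP => px.
  by apply: nN; split => // Tx; apply: nT; rewrite inE.
have mpE : measurable_fun setT (EFin \o p) by exact/measurable_EFinP.
have mp'E : measurable_fun setT (EFin \o p') by exact/measurable_EFinP.
have convE (f f' : G -> \bar R) x : (forall y, 0 <= f y) -> (forall y, 0 <= f' y) ->
    measurable_fun setT f -> measurable_fun setT f' ->
    (forall y, ~ N y -> f y = f' y) ->
    Defs.conv mul inv mu f (fun x => (p x)%:E) x =
    Defs.conv mul inv mu f' (fun x => (p' x)%:E) x.
  move=> f0 f'0 mf mf' fE.
  have cinv := continuous_inv_mulr HG (x := x).
  apply: ge0_ae_eq_integral => //.
  - exact: (emeasurable_funM mf (measurable_compG HG mpE cinv)).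
  - exact: (emeasurable_funM mf' (measurable_compG HG mp'E cinv)).
  - by move=> y _; rewrite mule_ge0// lee_fin.
  - by move=> y _; rewrite mule_ge0// lee_fin.
  have mphi : measurable ((fun y => mul (inv y) x) @^-1` N).
    by rewrite -[X in measurable X]setTI; apply: (continuous_measurableG HG cinv).
  (* The two integrands can differ only where [y] or [y^-1 x] lies in [N]; the second condition also
     defines a null set, by inversion and translation invariance. *)
  have : mu.-negligible (N `|` (fun y => mul (inv y) x) @^-1` N).
    by apply: negligibleU; apply/negligibleP => //;
      exact: etrans (measure_inv_mulr HG x mN) mu_N.
  apply: negligibleS => y /= /not_implyP[_ h]; apply: contrapT => /not_orP[nN nN'].
  by apply: h; rewrite fE// pE.
exists p'.
have p'_class : conv_class (EFin \o p').
  split; first by move=> x; rewrite lee_fin.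
    exact/measurable_EFinP.
  exists K; split => // x; rewrite /= eqe /p' indicE.
  have [/set_mem[n _ Kx]|_] := boolP (x \in T); first by exists n.
  by rewrite mulr0 eqxx.
split => //.
- move=> x; rewrite /p' p_sym !indicE; congr (_ * (nat_of_bool _)%:R)%R.
  apply/idP/idP; rewrite !inE; last exact: Tsym.
  by move=> /Tsym; rewrite invK.
- rewrite -ip; apply: ge0_ae_eq_integral => //.
  + by move=> x _; rewrite lee_fin.
  + by move=> x _; rewrite lee_fin.
  have : mu.-negligible N by apply/negligibleP.
  apply: negligibleS => y /= /not_implyP[_ h]; apply: contrapT => nN.
  by apply: h; rewrite pE.
- elim=> [|k IH].
    apply/funext => x; apply: (convE (EFin \o p) (EFin \o p')) => // y nN.
    by rewrite /= pE.
  have [q0 mq _] := convpow_class HG p'_class k.+2.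
  by apply/funext => x; rewrite /= -/convpow; rewrite -/(convpow _ _ _ _ k.+2) IH; exact: convE.
Qed.

End representative.

Lemma supnorm_nabla_le {d : measure_display} {R : realType} {G : TopMeasurable.type d}
    (mul : G -> G -> G) (one : G) (Omega : set G) (f : G -> \bar R) (M : \bar R) :
  Omega one -> (forall x y, Omega y -> `|f x - f (mul x y)| <= M)%E ->
  (supnorm (nabla mul Omega f) <= M)%E.
Proof.
move=> O1 fM; apply: ge_ereal_sup => _ [x _ <-].
(* As [Omega] contains [one], the supremum defining [nabla] is over a nonempty set of nonnegative
   values, which removes the outer absolute value. *)
rewrite gee0_abs; last first.
  apply: (@le_trans _ _ `|f x - f (mul x one)|%E) => //.
  by apply: ereal_sup_ubound; exists one.
by apply: ge_ereal_sup => _ [y Oy <-]; exact: fM.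
Qed.

(** * Gradient bound *)

Section gradient_bound.
Context {d : measure_display} {R : realType} {G : TopMeasurable.type d}.
Variables (mul : G -> G -> G) (inv : G -> G) (one : G).
Variable mu : {measure set G -> \bar R}.
Hypothesis HG : lc_unimodular_haar mul inv one mu.
Variable p : G -> R.
Hypotheses (p_class : conv_class (EFin \o p)) (p_sym : forall x, p (inv x) = p x).
Hypothesis p_int : (\int[mu]_x (p x)%:E = 1)%E.
Local Open Scope ereal_scope.

Local Notation q := (convpow mul inv mu p).
Local Notation a := (return_mass mul inv one mu p).

Variables (Omega : set G) (c0 : \bar R).
Hypotheses (Omega_meas : measurable Omega) (Omega_one : Omega one)
  (Omega_sym : forall x, Omega x -> Omega (inv x)) (c0_ge0 : 0 <= c0)
  (c0_le : forall x y, Omega x -> Omega y -> c0 <= q 2 (mul x y)).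

Let mulA x y z : mul x (mul y z) = mul (mul x y) z.
Proof. by have [[[+ _ _] _ _ _ _] _ _ _ _] := HG; exact. Qed.

Let mul1x x : mul one x = x.
Proof. by have [[[_ /(_ x)[+ _] _] _ _ _ _] _ _ _ _] := HG. Qed.

Let mulx1 x : mul x one = x.
Proof. by have [[[_ /(_ x)[_ +] _] _ _ _ _] _ _ _ _] := HG. Qed.

Let mulVx x : mul (inv x) x = one.
Proof. by have [[[_ _ /(_ x)[+ _]] _ _ _ _] _ _ _ _] := HG. Qed.

Let mulKx x y : mul (inv x) (mul x y) = y.
Proof. by rewrite mulA mulVx mul1x. Qed.

(** [c0 * mu Omega] is at most the integral of the density [q 2] over [Omega]. This makes [B] a real
    number. *)
Lemma mass_le1 : c0 * mu Omega <= 1.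
Proof.
have [q0 mq _] := convpow_class HG p_class 2.
rewrite -(integral_cst mu Omega_meas) -(convpow_int HG p_class p_int (isT : 0 < 2)%N).
apply: (@le_trans _ _ (\int[mu]_(x in Omega) q 2 x)).
  apply: (ge0_le_integral mu Omega_meas) => //; first exact: measurable_funTS.
  by move=> x Ox; rewrite /= -[x]mulx1; exact: c0_le.
exact: (ge0_subset_integral mu Omega_meas measurableT mq).
Qed.

Variables n m : nat.
Hypotheses (n0 : (0 < n)%N) (m0 : (0 < m)%N) (fn : q (n + n) one < +oo).

Local Notation N := (n + m)%N.
Local Notation f := (fun x => fine (q (n + N) x)).

Lemma convpow_tail_real x : q (n + N) x = (f x)%:E.
Proof.
rewrite fineK// (convpow_finite HG p_class p_sym)//; first by rewrite addn_gt0 n0.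
by apply: (return_finite HG p_class p_sym p_int n0 fn); exact: leq_addr.
Qed.

(** Settles the degenerate case where the right sides of the theorem vanish: later return values are
    0 by monotonicity, and the mean inequality then bounds [q (n + N)] by 0. *)
Lemma convpow_tail0 x : q (n + n) one = 0 -> q (n + N) x = 0.
Proof.
move=> A0; have fin := return_finite HG p_class p_sym p_int n0 fn.
have decr k : q (n + k + (n + k)) one = 0.
  elim: k => [|k IH]; first by rewrite addn0.
  apply/eqP; rewrite eq_le; apply/andP; split; last first.
    by have [] := convpow_class HG p_class (n + k.+1 + (n + k.+1)).
  rewrite -IH addnS; apply: (return_decr HG p_class p_sym p_int).
    by rewrite addn_gt0 n0.
  by apply: fin; exact: leq_addr.
have N0 : (0 < N)%N by rewrite addn_gt0 n0.
have := convpow_le_mean HG p_class p_sym x n0 N0.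
rewrite A0 decr convpow_tail_real adde0 -EFinM lee_fin => h.
have : (0 <= f x)%R by apply: fine_ge0; have [] := convpow_class HG p_class (n + N).
by move: h; move: (f x) => r h1 h2; congr (_%:E); lra.
Qed.

Variable s : R.
Hypotheses (s0 : (0 < s)%R) (s2 : m%:R%:E * (c0 * mu Omega) = (s ^+ 2)%:E).

Lemma convpow_lipschitz_Omega x y : Omega y ->
  (f x - f (mul x y) <= 2 * s^-1 * a n)%R /\
  (f (mul x y) - f x <= 2 * s^-1 * a n)%R.
Proof.
move=> Oy; have nN : (n <= N)%N by exact: leq_addr.
have N0 : (0 < N)%N by rewrite addn_gt0 n0.
have fN := return_finite HG p_class p_sym p_int n0 fn nN.
have an0 : (0 <= a n)%R by exact: (return_mass_ge0 HG p_class).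
(* With [e] the decrement of [a] at [N], [Omega_gap] and [return_gap] bound the left side by
   [4 m e <= 2 (2m + 1) e <= 2 a n]. *)
have gap z : Omega z -> (s ^+ 2 * (a N - fine (q (N + N) z)) <= 2 * a n)%R.
  move=> Oz; have := Omega_gap HG p_class p_sym p_int n0 fn nN Omega_meas c0_ge0.
  move=> /(_ z) H.
  have {}H : c0 * mu Omega * (a N - fine (q (N + N) z))%:E <= (4 * (a N - a N.+1))%:E.
    apply: H => w Ow; split; last by apply: c0_le => //; exact: Omega_sym.
    by rewrite -[w]mulx1; exact: c0_le.
  have m0' : (0 < m%:R :> R)%R by rewrite ltr0n.
  have : (s ^+ 2 * (a N - fine (q (N + N) z)) <= m%:R * (4 * (a N - a N.+1)))%R.
    rewrite -lee_fin EFinM -s2 [in leRHS]EFinM -muleA.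
    by apply: lee_wpmul2l => //; rewrite lee_fin ler0n.
  have := return_gap HG p_class p_sym p_int n0 fn m.
  have D0 : (0 <= a N - a N.+1)%R.
    rewrite subr_ge0 -lee_fin -(return_massE HG p_class p_sym p_int n0 fn nN).
    rewrite -(return_massE HG p_class p_sym p_int n0 fn (leqW nN)).
    exact: (return_decr HG p_class p_sym p_int).
  rewrite -addn1 -mul2n natrD natrM => h1 h2; apply: le_trans h2 _.
  by move: h1 D0; move: (a N - _)%R (a n) (m%:R)%R => e b c h1 D0; nra.
(* With the parameter [2 / s], each of the two terms of [convpow_lipschitz] is at most [a n / s]. *)
have t0 : (0 < 2 * s^-1)%R by rewrite mulr_gt0// invr_gt0.
have lip x1 x2 z : mul (inv x1) x2 = z -> Omega z ->
    (f x1 - f x2 <= 2 * s^-1 * a n)%R.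
  move=> <- Oz; apply: le_trans
    (convpow_lipschitz HG p_class p_sym x1 x2 n0 N0 t0 fn fN) _.
  move: (gap _ Oz); rewrite -/(a N) -/(a n).
  move: (a N - _)%R (a n) => D b hD.
  rewrite -subr_ge0.
  rewrite (_ : _ - _ = s^-1 / 2 * (2 * b - s ^+ 2 * D))%R; last first.
    by field; rewrite gt_eqF.
  by rewrite mulr_ge0 ?subr_ge0// divr_ge0// invr_ge0 ltW.
split; first exact: (lip _ _ y).
apply: (lip _ _ (inv y)); last exact: Omega_sym.
have mulxV z : mul z (inv z) = one by have [[[_ _ /(_ z)[_ +]] _ _ _ _] _ _ _ _] := HG.
by rewrite -[RHS](mulKx (mul x y)) -[X in _ = mul _ X]mulA mulxV mulx1.
Qed.

Lemma convpow_word k z : setpow mul one Omega k z ->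
  (`|f z - f one| <= k%:R * (2 * s^-1 * a n))%R.
Proof.
elim: k z => [z ->|k IH _ [x [y [/IH hx [Oy ->]]]]].
  by rewrite subrr normr0 mul0r.
have [h1 h2] := convpow_lipschitz_Omega x Oy.
have -> : (f (mul x y) - f one = (f x - f one) + (f (mul x y) - f x))%R.
  by rewrite [RHS]addrC addrA subrK.
apply: le_trans (ler_normD _ _) _; rewrite -natr1 mulrDl mul1r.
by apply: lerD => //; rewrite ler_norml lerNl opprB h1.
Qed.

Local Notation C := (2 * s^-1 * a n)%R.

Lemma nabla_convpow_le :
  supnorm (nabla mul Omega (q (n + N))) <= (2 * s^-1 * a n)%:E.
Proof.
apply: (supnorm_nabla_le Omega_one) => x y Oy.
have [h1 h2] := convpow_lipschitz_Omega x Oy.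
rewrite (convpow_tail_real x) (convpow_tail_real (mul x y)) -EFinB lee_fin.
by rewrite ler_norml lerNl opprB; apply/andP.
Qed.

Lemma convpow_word_length x :
  `|q (n + N) x - q (n + N) one| <=
  (2 * s^-1 * a n)%:E * word_length mul one Omega x.
Proof.
have an0 : (0 <= a n)%R by exact: (return_mass_ge0 HG p_class).
rewrite (convpow_tail_real x) (convpow_tail_real one) -EFinB /=.
(* The other case divides by [C] to pass to the infimum over word lengths. Here the right side is 0
   even for an infinite word length, so the left side has to vanish. *)
have [a0|a0] := eqVneq (a n) 0%R.
  have A0 : q (n + n) one = 0.
    by rewrite (return_massE HG p_class p_sym p_int n0 fn (leqnn n)) a0.
  by rewrite !(convpow_tail0 _ A0) /= subrr normr0 a0 mulr0 mul0e.
have C0 : (0 < C)%R by rewrite !mulr_gt0 ?invr_gt0// lt_neqAle eq_sym a0.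
rewrite -lee_pdivrMl//; apply: le_ereal_inf_tmp => _ [k [_ kx] <-].
by rewrite lee_pdivrMl// muleC -EFinM lee_fin; exact: convpow_word.
Qed.

End gradient_bound.

Theorem theorem5p1 (d : measure_display) (R : realType) (G : TopMeasurable.type d)
  (mul : G -> G -> G) (inv : G -> G) (one : G)
  (mu : {measure set G -> \bar R})
  (HG : lc_unimodular_haar mul inv one mu)
  (p : G -> R)
  (p_ge0 : forall x, 0 <= p x)
  (p_meas : measurable_fun [set: G] p)
  (p_int1 : (\int[mu]_x (p x)%:E = 1)%E)
  (p_sym : forall x, p (inv x) = p x)
  (Omega : set G)
  (Omega_meas : measurable Omega)
  (Omega_sym : forall x, Omega x -> Omega (inv x))
  (Omega_one : Omega one)
  (c0_pos : (0 < ereal_inf [set convpow mul inv mu p 2 x | x in setpow mul one Omega 2])%E) :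
  let c0 := ereal_inf [set convpow mul inv mu p 2 x | x in setpow mul one Omega 2] in
  let B := (c0 * mu Omega)%E in
  forall n m : nat, (1 <= n)%N -> (1 <= m)%N ->
    ((supnorm (nabla mul Omega (convpow mul inv mu p (2 * n + m)))
        <= 2%:E * inv_sqrtE (m%:R%:E * B) * convpow mul inv mu p (2 * n) one)
     /\
     (forall x : G,
        `|convpow mul inv mu p (2 * n + m) x - convpow mul inv mu p (2 * n + m) one|
        <= 2%:E * inv_sqrtE (m%:R%:E * B) * word_length mul one Omega x
             * convpow mul inv mu p (2 * n) one))%E.
Proof.
move=> c0 B n m n0 m0.
have [p' [p'_class p'_sym p'_int pp']] :=
  sigma_compact_representative HG p_ge0 p_meas p_int1 p_sym.
(* The exponents [2], [2n] and [2n + m] of the statement are all at least 2, where the powers of [p]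
   and [p'] agree. *)
have ppk k : (1 < k)%N -> convpow mul inv mu p k = convpow mul inv mu p' k.
  by case: k => [|[|k]].
have e2n : (2 * n = n + n)%N by rewrite mul2n addnn.
have nn1 : (1 < n + n)%N by exact: (leq_add n0 n0).
have enm : (2 * n + m = n + (n + m))%N by rewrite e2n addnA.
have nm1 : (1 < n + (n + m))%N by rewrite addnA (leq_trans nn1)// leq_addr.
rewrite enm e2n !(ppk _ nm1) !(ppk _ nn1).
have c0_ge0 : (0 <= c0)%E by exact: ltW.
have mul1x x : mul one x = x.
  by have [[[_ /(_ x)[+ _] _] _ _ _ _] _ _ _ _] := HG.
have c0_le x y : Omega x -> Omega y ->
    (c0 <= convpow mul inv mu p' 2 (mul x y))%E.
  move=> Ox Oy; rewrite -ppk//; apply: ereal_inf_lbound; exists (mul x y) => //.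
  by exists x, y; split => //; exists one, x; rewrite mul1x.
have [q0 _ _] := convpow_class HG p'_class (n + n).
have [qN0 _ _] := convpow_class HG p'_class (n + (n + m)).
have B1 : (B <= 1)%E by exact: (mass_le1 HG p'_class p'_int Omega_meas Omega_one c0_ge0 c0_le).
have B0 : (0 <= B)%E by rewrite mule_ge0.
have [b Bb] : exists b : R, B = b%:E.
  by exists (fine B); rewrite fineK// ge0_fin_numE// (le_lt_trans B1)// ltry.
have b0 : 0 <= b by rewrite -lee_fin -Bb.
have inv_gt0 : (0 < inv_sqrtE (m%:R%:E * B))%E.
  by rewrite Bb /=; case: ifPn => // mb0; rewrite lte_fin invr_gt0 sqrtr_gt0.
have w1 x : (1 <= word_length (R := R) mul one Omega x)%E.
  by apply: le_ereal_inf_tmp => _ [k [k1 _] <-]; rewrite lee_fin ler1n.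
have w0 x : (0 < word_length (R := R) mul one Omega x)%E.
  by apply: lt_le_trans (w1 x); rewrite lte01.
(* Infinite return value: the other factors are positive, the word length being at least 1, so both
   bounds are infinite. *)
have [A_oo|A_fin] := eqVneq (convpow mul inv mu p' (n + n) one) +oo%E.
  rewrite A_oo; split=> [|x].
    by rewrite gt0_muley ?leey// mule_gt0.
  by rewrite gt0_muley ?leey// !mule_gt0.
have fn : (convpow mul inv mu p' (n + n) one < +oo)%E by rewrite ltey.
(* Zero return value: the right sides are 0 even if another factor is infinite, so the left sides
   must be shown to vanish. *)
have [A0|A_neq0] := eqVneq (convpow mul inv mu p' (n + n) one) 0%E.
  have f0 x : convpow mul inv mu p' (n + (n + m)) x = 0%E.
    exact: (convpow_tail0 HG p'_class p'_sym p'_int m n0 fn).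
  rewrite A0 !mule0; split=> [|x].
    by apply: (supnorm_nabla_le Omega_one) => x y _; rewrite !f0 sube0 abse0.
  by rewrite !f0 mule0 sube0 abse0.
have A_gt0 : (0 < convpow mul inv mu p' (n + n) one)%E.
  by rewrite lt_neqAle eq_sym A_neq0 q0.
(* If [B = 0], the factor [inv_sqrtE] is infinite by convention and the remaining factors are
   positive, so both bounds are trivial. *)
have [b_eq0|b_neq0] := eqVneq b 0.
  have -> : inv_sqrtE (m%:R%:E * B) = +oo%E.
    by rewrite Bb b_eq0 mule0 /= ltxx.
  rewrite gt0_muley//; split=> [|x]; first by rewrite gt0_mulye ?leey.
  by rewrite !gt0_mulye ?leey.
have mb_gt0 : 0 < m%:R * b by rewrite mulr_gt0 ?ltr0n// lt_neqAle eq_sym b_neq0.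
pose s := Num.sqrt (m%:R * b).
have s_gt0 : 0 < s by rewrite sqrtr_gt0.
have s2 : (m%:R%:E * (c0 * mu Omega) = (s ^+ 2)%:E)%E.
  by rewrite -/B Bb -EFinM /s sqr_sqrtr// ltW.
have -> : inv_sqrtE (m%:R%:E * B) = (s^-1)%:E by rewrite Bb /= mb_gt0.
rewrite [X in (_ * X)%E](return_massE HG p'_class p'_sym p'_int n0 fn (leqnn n)).
split=> [|x].
  rewrite -!EFinM.
  exact: (nabla_convpow_le HG p'_class p'_sym p'_int Omega_meas Omega_one Omega_sym
    c0_ge0 c0_le n0 m0 fn s_gt0 s2).
rewrite (return_massE HG p'_class p'_sym p'_int n0 fn (leqnn n)) muleAC -!EFinM.
exact: (convpow_word_length HG p'_class p'_sym p'_int Omega_meas Omega_one Omega_sym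
  c0_ge0 c0_le n0 m0 fn s_gt0 s2).
Qed.
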